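(* Let $r>0$, let $Q,\widetilde Q\in\mathbb{U}_{1,r}^{2\times2}$, and let $K_Q^\pm$, $K_{\widetilde Q}^\pm$ be the kernels of the corresponding transformation operators. Then there is a constant $C=C(r,B)>0$, not depending on $Q,\widetilde Q$, such that for all $x\in[0,1]$ and $\lambda\in\mathbb{C}$ $$\sum_{j,k=1}^2\left|\int_0^x\bigl(K_Q^\pm-K_{\widetilde Q}^\pm\bigr)_{jk}(x,t)\,e^{ib_k\lambda t}\,dt\right|\le C e^{2(b_2-b_1)|\operatorname{Im}\lambda|x}\sum_{j\ne k}\left(\sup_{s\in[0,x]}\left|\int_0^s\bigl(Q_{jk}(t)-\widetilde Q_{jk}(t)\bigr)e^{i(b_k-b_j)\lambda t}dt\right|+\|Q-\widetilde Q\|_1\sup_{s\in[0,x]}\left|\int_0^s\widetilde Q_{jk}(t)e^{i(b_k-b_j)\lambda t}dt\right|\right),$$ where the sum on the right is over $(j,k)\in\{(1,2),(2,1)\}$.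
   Context: Fix real numbers $b_1<0<b_2$ and $B=\operatorname{diag}(b_1,b_2)$. A potential matrix is $Q=\begin{pmatrix}0&Q_{12}\\Q_{21}&0\end{pmatrix}$ with entries in $L^1[0,1]$; $\|Q\|_1$ is its norm in $L^1([0,1];\mathbb{C}^{2\times 2})$, and $\mathbb{U}_{1,r}^{2\times2}$ is the set of potential matrices with $\|Q\|_1\le r$. Let $\Omega=\{(x,t):0\le t\le x\le1\}$; $X^0_{1,1}(\Omega)$ and $X^0_{\infty,1}(\Omega)$ are the completions (closures of $C(\Omega)$) in the norms $\operatorname{ess\,sup}_{t}\int_t^1|f(x,t)|dx$ and $\operatorname{ess\,sup}_{x}\int_0^x|f(x,t)|dt$, respectively. For $f\in X^0_{\infty,1}(\Omega)$ and each $x\in[0,1]$ the trace $f(x,\cdot)\in L^1[0,x]$ is well defined by continuous extension from $C(\Omega)$. Transformation operators: let $e_{\pm}(\cdot,\lambda)$ be the solution of $-iB^{-1}y'+Q(x)y=\lambda y$ on $[0,1]$ with $e_\pm(0,\lambda)=\binom{1}{\pm1}$, and $e^0_\pm(x,\lambda)=\binom{e^{ib_1\lambda x}}{\pm e^{ib_2\lambda x}}$. It is known that there are (uniquely determined) $2\times2$ matrix kernels $K^\pm_Q$ with entries in $X^0_{1,1}(\Omega)\cap X^0_{\infty,1}(\Omega)$ such that $$e_\pm(x,\lambda)=e^0_\pm(x,\lambda)+\int_0^xK_Q^\pm(x,t)e^0_\pm(t,\lambda)\,dt,\qquad x\in[0,1],\ \lambda\in\mathbb{C}.$$ *)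

(* Defs.v *)
From HB Require Import structures.
From mathcomp Require Import all_boot all_order all_algebra.
From mathcomp Require Import complex.
From mathcomp Require Import all_classical all_reals all_analysis.
From mathcomp Require Import ess_sup_inf.
Set Implicit Arguments.
Unset Strict Implicit.
Unset Printing Implicit Defensive.
Import Order.TTheory GRing.Theory Num.Theory.
Import numFieldNormedType.Exports.
Local Open Scope classical_set_scope.
Local Open Scope ring_scope.

Section complex_analysis.
Context {R : realType}.
Local Notation C := R[i].
Implicit Types (z : C) (D : set R) (f : R -> C).

Definition cabs z : R := complex.Re `|z|.

Definition cexp z : C :=
  Complex (expR (complex.Re z) * cos (complex.Im z))
          (expR (complex.Re z) * sin (complex.Im z)).

(* e^{i a lambda t} *)
Definition cphase (a : R) (lambda : C) (t : R) : C :=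
  cexp ('i%C * a%:C%C * lambda * t%:C%C).

(* As mu.-integrable entails measurability on D, this is f \in L^1(D). *)
Definition L1_on D f : Prop :=
  lebesgue_measure.-integrable D (fun t => (complex.Re (f t))%:E) /\
  lebesgue_measure.-integrable D (fun t => (complex.Im (f t))%:E).

Definition cint D f : C :=
  Complex (\int[lebesgue_measure]_(t in D) complex.Re (f t))
          (\int[lebesgue_measure]_(t in D) complex.Im (f t)).

Definition sup_int (x : R) f : R :=
  sup [set cabs (cint `[0, s] f) | s in `[0, x]].

End complex_analysis.

Section kernel_spaces.
Context {R : realType}.
Local Notation C := R[i].
Local Notation mu := (@lebesgue_measure R).
Implicit Types (f g : R * R -> C) (h : nat -> R * R -> C).

Definition Omega : set (R * R) := [set p | 0 <= p.2 <= p.1 /\ p.1 <= 1].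

Definition continuous_Omega f : Prop :=
  {within Omega, continuous (fun p => complex.Re (f p))} /\
  {within Omega, continuous (fun p => complex.Im (f p))}.

Definition measurable_Omega f : Prop :=
  measurable_fun Omega (fun p => complex.Re (f p)) /\
  measurable_fun Omega (fun p => complex.Im (f p)).

(* Both norms are [0, +oo]-valued; extending the inner integral by 0 outside
   [0, 1] does not change the essential supremum over [0, 1]. *)
Definition norm_X11 f : \bar R :=
  ess_sup mu ((fun t => \int[mu]_(x in `[t, 1%R]) (cabs (f (x, t)))%:E)%E
              \_ `[0, 1]).

Definition norm_Xinf1 f : \bar R :=
  ess_sup mu ((fun x => \int[mu]_(t in `[0%R, x]) (cabs (f (x, t)))%:E)%E
              \_ `[0, 1]).

Definition approximates (norm : (R * R -> C) -> \bar R) h f : Prop :=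
  (forall n, continuous_Omega (h n)) /\
  norm (fun p => f p - h n p) @[n --> \oo] --> 0%E.

(* Elements of these spaces are represented by functions, which matter only up
   to equality almost everywhere on Omega. *)
Definition X0_11 f : Prop :=
  measurable_Omega f /\ exists h, approximates norm_X11 h f.

Definition X0_inf1 f : Prop :=
  measurable_Omega f /\ exists h, approximates norm_Xinf1 h f.

(* The value at f of the continuous extension to X0_inf1 of the map
   h |-> h (x, _) from continuous functions to L^1[0, x]. It depends only on
   the class of f, unlike the section t |-> f (x, t), and is itself determined
   up to equality almost everywhere on [0, x]. *)
Definition is_trace f (x : R) (g : R -> C) : Prop :=
  L1_on `[0, x] g /\
  forall h, approximates norm_Xinf1 h f ->
    (\int[mu]_(t in `[0%R, x]) (cabs (h n (x, t) - g t))%:E)%E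
      @[n --> \oo] --> 0%E.

Definition trace_at f (x : R) : R -> C := xget (fun=> 0) (is_trace f x).

Definition trace_mx (K : R * R -> 'M[C]_2) (x t : R) : 'M[C]_2 :=
  \matrix_(j, k) trace_at (fun p => K p j k) x t.

End kernel_spaces.

Section dirac_system.
Context {R : realType}.
Local Notation C := R[i].
Implicit Types (Q : R -> 'M[C]_2) (b : R).

Definition bcoef b1 b2 (k : 'I_2) : R := if k == ord0 then b1 else b2.

Definition Bmx b1 b2 : 'M[C]_2 := diag_mx (\row_k ((bcoef b1 b2 k)%:C)%C).

Definition potential Q : Prop :=
  (forall x (j : 'I_2), x \in `[0, 1] -> Q x j j = 0) /\
  (forall j k, L1_on `[0, 1] (fun x => Q x j k)).

Definition norm_L1 Q : R :=
  \int[lebesgue_measure]_(x in `[0, 1]) \sum_(j < 2) \sum_(k < 2) cabs (Q x j k).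

Definition U1 (r : R) Q : Prop := potential Q /\ norm_L1 Q <= r.

(* y is absolutely continuous on [0, 1] with derivative dy. *)
Definition AC_derivative (y dy : R -> 'cV[C]_2) : Prop :=
  forall j : 'I_2, L1_on `[0, 1] (fun t => dy t j ord0) /\
    forall x, x \in `[0, 1] ->
      y x j ord0 = y 0 j ord0 + cint `[0, x] (fun t => dy t j ord0).

Definition dirac_solution b1 b2 Q (lambda : C) (y : R -> 'cV[C]_2) : Prop :=
  exists dy, AC_derivative y dy /\
    {ae lebesgue_measure, forall x : R, x \in `[0, 1] ->
      - 'i%C *: (invmx (Bmx b1 b2) *m dy x) + Q x *m y x = lambda *: y x}.

(* e^0_+ for s = false and e^0_- for s = true. *)
Definition e0 b1 b2 (s : bool) (lambda : C) (x : R) : 'cV[C]_2 :=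
  \col_k ((if k == ord0 then 1 else (-1) ^+ s) *
          cphase (bcoef b1 b2 k) lambda x).

(* The solution e_+ or e_- with y(0) = (1, +-1) is unique, so it may be
   introduced existentially. *)
Definition transformation_kernel b1 b2 (s : bool) Q
    (K : R * R -> 'M[C]_2) : Prop :=
  (forall j k, X0_11 (fun p => K p j k) /\ X0_inf1 (fun p => K p j k)) /\
  forall lambda : C, exists y : R -> 'cV[C]_2,
    [/\ dirac_solution b1 b2 Q lambda y,
        y 0 = \col_k (if k == ord0 then 1 else (-1) ^+ s) &
        forall x, x \in `[0, 1] ->
          y x = e0 b1 b2 s lambda x +
            \col_j cint `[0, x]
              (fun t => (trace_mx K x t *m e0 b1 b2 s lambda t) j ord0)].

End dirac_system.

(* Main.v *)
Require Import Defs.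
From mathcomp Require Import all_boot all_order all_algebra.
From mathcomp Require Import complex.
From mathcomp Require Import all_classical all_reals all_analysis.
From mathcomp Require Import ess_sup_inf.
From mathcomp Require Import measurable_realfun.
From mathcomp Require Import ring lra.
Import Order.TTheory GRing.Theory Num.Theory.
Import numFieldNormedType.Exports.
Local Open Scope classical_set_scope.
Local Open Scope ring_scope.

(** Why the estimate holds. Write [e] and [et] for the solutions of the two Dirac
    systems, [K] and [Kt] for their kernels, [F] for the free solution.

    The kernels enter through the transformation formula, whose [j]-th row
    expresses [e_j(x, lam) - F_j(x, lam)] as the sum of an integral of [K_j1]
    against [exp(i b1 lam t)] and one of [K_j2] against [exp(i b2 lam t)]. These
    are the parts, over negative and over positive phases [u], of one and the same
    Fourier integral, and the theorem bounds them separately. They are separated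
    by weighting [exp(i lam u)] with the polynomial
    [W_n(u) = (1 - (exp(mu u) / 2)^n)^(2^n)] in [exp(mu u)], which tends to 1 for
    [u < 0] and to 0 for [u > 0]. As the formula holds for every complex spectral
    parameter, the weighting amounts to replacing [e_j(x, lam)] by a finite
    superposition of the values [e_j(x, lam - i mu m)], and dominated convergence
    recovers the integral of [K_j1] as [n] grows ([first_column_bound]). It
    remains to bound the same superposition of the differences [e - et],
    uniformly in [n].

    With weights [a_m] and parameters [lam_m], the function
    [z_j(x, theta) = sum_m a_m exp(i lam_m theta) e_j(x, lam_m)] satisfies
    [z_j(x, theta) = c_j f(theta + b_j x)
       - i b_j int_0^x Q_jk(s) z_k(s, theta + b_j (x - s)) ds], where
    [f(u) = sum_m a_m exp(i lam_m u)] and [k] is the index other than [j]. This is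
    a hyperbolic system with speeds [b1] and [b2] in which the parameters no longer
    occur. Gronwall's inequality bounds [z] by the supremum of [f] over the
    interval of dependence, with a constant that depends only on the norm of [Q]
    ([propagation]).

    The difference of the superpositions for [Q] and [Qt] solves the system of
    [Qt] with the forcing term
    [- i b_j int_0^x (Q - Qt)_jk(s) z_k(s, theta + b_j (x - s)) ds]. Inserting the
    equation of [z_k] and exchanging the integrals turns it into an integral of
    superpositions in which [a_m] is multiplied by
    [int_sig^x (Q - Qt)_jk(s) exp(i (b_k - b_j) lam_m s) ds] ([forcing_split]).
    These are again superpositions of solutions, now with the data
    [int_sig^x (Q - Qt)_jk(s) f(eta + (b_k - b_j) s) ds]. Here [f] is
    [exp(i lam u) W_n(u)] with a monotone [W_n] between 0 and 1, so the second mean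
    value theorem bounds the data by the oscillatory integrals of [Q - Qt] at [lam]
    alone ([oscillation_bound]). By [propagation] the forcing term is bounded in
    the same way, and so is the difference ([stability]). The phases [eta] that
    occur satisfy [|eta| <= 2 (b2 - b1) x], which is the origin of the exponential
    factor.

    Finally, the integrals of the theorem involve traces, which are defined by
    approximation in the norm of the kernel space. They exist because L1 is
    complete, and depend linearly on the kernel up to null sets ([trace_atB]). *)

Set Implicit Arguments.
Unset Strict Implicit.
Unset Printing Implicit Defensive.

(** * Real integrals over a triangle *)

Section real_swap.
Context {R : realType}.
Local Notation mu := (@lebesgue_measure R).
Implicit Types (f g : R -> R) (a x : R).

(** Stated with the extended-real integrability predicate, so that the two
    halves of [L1_on] are instances of it by conversion. *)
Definition L1R (D : set R) f := mu.-integrable D (EFin \o f).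

Lemma L1R_restrict (D : set R) f : measurable D -> L1R D f -> L1R setT (f \_ D).
Proof.
move=> mD fi; rewrite /L1R -restrict_EFin.
by apply/(integrable_restrict mu mD measurableT); rewrite setTI.
Qed.

Lemma eq_L1R (D : set R) f g : measurable D -> {in D, f =1 g} ->
  L1R D f -> L1R D g.
Proof.
by move=> mD fg; apply: eq_integrable => // t tD; rewrite /= fg.
Qed.

Lemma L1RS (E D : set R) f : measurable E -> measurable D -> D `<=` E ->
  L1R E f -> L1R D f.
Proof. by move=> mE mD DE; exact: integrableS. Qed.

Lemma L1RD (D : set R) f g : measurable D -> L1R D f -> L1R D g ->
  L1R D (fun t => f t + g t).
Proof. by move=> mD fi gi; exact: (integrableD _ fi gi). Qed.

Lemma L1RB (D : set R) f g : measurable D -> L1R D f -> L1R D g ->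
  L1R D (fun t => f t - g t).
Proof. by move=> mD fi gi; exact: (integrableB _ fi gi). Qed.

Lemma L1RZl (D : set R) c f : measurable D -> L1R D f ->
  L1R D (fun t => c * f t).
Proof. by move=> mD fi; exact: (integrableZl _ c fi). Qed.

Lemma L1R_norm (D : set R) f : measurable D -> L1R D f ->
  L1R D (fun t => `|f t|).
Proof. by move=> mD fi; exact: (integrable_norm fi). Qed.

Lemma L1R_bmul (D : set R) (M : R) f g : measurable D -> measurable_fun D f ->
  (forall t, D t -> `|f t| <= M) -> L1R D g -> L1R D (fun t => f t * g t).
Proof.
move=> mD mf fM gi.
have mg : measurable_fun D g by apply/measurable_EFinP; exact: measurable_int gi.
apply: (le_integrable _ _ _ (L1RZl M mD gi)) => //.
  by apply/measurable_EFinP; exact: measurable_funM.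
move=> t Dt; rewrite /= lee_fin !normrM ler_wpM2r//.
by rewrite (le_trans (fM t Dt))// ler_norm.
Qed.

(** Extending by 0 outside of the interval lets Fubini's theorem run over the
    whole plane, with the triangle cut out by the indicator in [ker]. *)
Let f0 a x f : R -> R := f \_ `[a, x].

Let ker a x f g : R * R -> \bar R := fun p =>
  (f0 a x f p.1 * (f0 a x g p.2 * \1_[set p : R * R | p.2 <= p.1] p))%:E.

Let measurable_le : measurable [set p : R * R | p.2 <= p.1].
Proof.
rewrite (_ : [set _ | _] = (fun p : R * R => p.1 - p.2) @^-1` `[0, +oo[).
  rewrite -[X in measurable X]setTI.
  by apply: (measurable_funB (@measurable_fst _ _ R R) (@measurable_snd _ _ R R)) => //.
by apply/seteqP; split => p /=; rewrite in_itv/= andbT subr_ge0.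
Qed.

Let measurable_ker a x f g : L1R `[a, x] f -> L1R `[a, x] g ->
  measurable_fun setT (ker a x f g).
Proof.
move=> /L1R_restrict-/(_ (measurable_itv _))/measurable_int/measurable_EFinP mf.
move=> /L1R_restrict-/(_ (measurable_itv _))/measurable_int/measurable_EFinP mg.
apply/measurable_EFinP/measurable_funM.
  by apply: (measurableT_comp mf); exact: measurable_fst.
apply: measurable_funM.
  by apply: (measurableT_comp mg); exact: measurable_snd.
exact: measurable_indic.
Qed.

Let integrable_ker a x f g : L1R `[a, x] f -> L1R `[a, x] g ->
  (mu \x mu)%E.-integrable setT (ker a x f g).
Proof.
move=> fi gi; have mk := measurable_ker fi gi.
have f0i := L1R_restrict (measurable_itv _) fi.
have g0i := L1R_restrict (measurable_itv _) gi.
apply: (iffRL (integrable12ltyP mu mu mk)).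
have [mg0 g0y] := integrableP _ _ _ g0i.
have [mf0 f0y] := integrableP _ _ _ f0i.
have amf0 : measurable_fun setT (fun s => `|(f0 a x f s)%:E|%E).
  exact: (measurableT_comp (@abse_measurable R setT)).
have amg0 : measurable_fun setT (fun s => `|(f0 a x g s)%:E|%E).
  exact: (measurableT_comp (@abse_measurable R setT)).
have gfin : (\int[mu]_t `|(f0 a x g t)%:E|)%E \is a fin_num.
  by rewrite ge0_fin_numE// integral_ge0.
apply: (@le_lt_trans _ _ (\int[mu]_s (`|(f0 a x f s)%:E| * \int[mu]_t `|(f0 a x g t)%:E|))%E).
  apply: ge0_le_integral => //=.
  - by move=> s _; apply: integral_ge0.
  - apply: (measurable_fun_fubini_tonelli_F (m2 := mu) (fun p => `|ker a x f g p|)%E) => //.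
    exact: measurableT_comp.
  - exact: emeasurable_funM.
  - move=> s _; rewrite -ge0_integralZl//=.
    + apply: ge0_le_integral => //=.
      * have mks : measurable_fun setT (fun t => ker a x f g (s, t)).
          exact: (measurableT_comp mk (measurable_pair1 s)).
        exact: (measurableT_comp (@abse_measurable R setT) mks).
      * exact: emeasurable_funM.
      * move=> t _; rewrite -EFinM lee_fin normrM ler_wpM2l//.
        rewrite normrM ler_piMr//.
        by rewrite indicE; case: (_ \in _); rewrite ?normr1 ?normr0.
rewrite ge0_integralZr//=; last exact: integral_ge0.
by apply: lte_mul_pinfty => //; rewrite ?integral_ge0 ?ge0_fin_numE ?integral_ge0.
Qed.

Let ker_F a x f g s : L1R `[a, x] g ->
  fubini_F mu (ker a x f g) s =
  (((fun s => f s * \int[mu]_(t in `[a, s]) g t) \_ `[a, x]) s)%:E.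
Proof.
move=> gi; rewrite /fubini_F /ker patchE.
case: ifPn => [sxb|/negbTE sx]; last first.
  by rewrite integral0_eq// => t _ /=; rewrite /f0 patchE sx mul0r.
have sx := set_mem sxb; rewrite /= in sx.
have s0x : `[a, s] `<=` `[a, x].
  move: sx; rewrite in_itv/= => /andP[s0 sx] t /=; rewrite !in_itv/= => /andP[->/=].
  by move=> /le_trans; exact.
have gis : L1R `[a, s] g by apply: integrableS gi.
rewrite EFinM /Rintegral fineK; last by apply: integrable_fin_num.
rewrite [in RHS]integral_mkcond/=.
rewrite -integralZl//=; last first.
  by rewrite restrict_EFin; apply: L1R_restrict.
apply: eq_integral => t _; rewrite patchE /f0 !patchE sxb.
rewrite indicE.
have -> : ((s, t) \in [set p : R * R | p.2 <= p.1]) = (t <= s).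
  by apply/idP/idP => [/set_mem//|ts]; apply/mem_set.
have [ts|nts] := boolP (t \in `[a, s]%classic).
  rewrite (mem_set (s0x _ (set_mem ts))).
  by move/set_mem: ts => /=; rewrite in_itv/= => /andP[_ ->]; rewrite mulr1 EFinM.
rewrite mule0; case: ifPn => [/set_mem/=|_]; last by rewrite mul0r mulr0.
rewrite in_itv/= => /andP[t0 tx].
case: (leP t s) => ts; last by rewrite !mulr0.
by case/negP: nts; rewrite inE/= in_itv/= t0.
Qed.

Let ker_G a x f g t : L1R `[a, x] f ->
  fubini_G mu (ker a x f g) t =
  (((fun t => g t * \int[mu]_(s in `[t, x]) f s) \_ `[a, x]) t)%:E.
Proof.
move=> fi; rewrite /fubini_G /ker patchE.
case: ifPn => [txb|/negbTE tx]; last first.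
  by rewrite integral0_eq// => s _ /=; rewrite /f0 !patchE tx mul0r mulr0.
have tx := set_mem txb; rewrite /= in tx.
have s0x : `[t, x] `<=` `[a, x].
  move: tx; rewrite in_itv/= => /andP[t0 tx] s /=; rewrite !in_itv/= => /andP[ts ->].
  by rewrite (le_trans t0 ts).
have fis : L1R `[t, x] f by apply: integrableS fi.
rewrite EFinM /Rintegral fineK; last by apply: integrable_fin_num.
rewrite [in RHS]integral_mkcond/=.
rewrite -integralZl//=; last first.
  by rewrite restrict_EFin; apply: L1R_restrict.
apply: eq_integral => s _; rewrite patchE /f0 !patchE txb.
rewrite indicE.
have -> : ((s, t) \in [set p : R * R | p.2 <= p.1]) = (t <= s).
  by apply/idP/idP => [/set_mem//|ts]; apply/mem_set.
have [ts|nts] := boolP (s \in `[t, x]%classic).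
  rewrite (mem_set (s0x _ (set_mem ts))).
  by move/set_mem: ts => /=; rewrite in_itv/= => /andP[-> _]; rewrite mulr1 mulrC EFinM.
rewrite mule0; case: ifPn => [/set_mem/=|_]; last by rewrite mul0r.
rewrite in_itv/= => /andP[s0 sx].
case: (leP t s) => ts; last by rewrite !mulr0.
by case/negP: nts; rewrite inE/= in_itv/= ts.
Qed.

Lemma L1R_lower a x f g : L1R `[a, x] f -> L1R `[a, x] g ->
  L1R `[a, x] (fun s => f s * \int[mu]_(t in `[a, s]) g t).
Proof.
move=> fi gi; pose F s := f s * \int[mu]_(t in `[a, s]) g t.
have : mu.-integrable setT (EFin \o (F \_ `[a, x])).
  have h := integrable_fubini_F (integrable_ker fi gi).
  apply: (eq_integrable measurableT _ _ _ h).
  by move=> s _; exact: ker_F.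
rewrite -restrict_EFin => /(integrable_restrict mu (measurable_itv _) measurableT).
by rewrite setTI.
Qed.

Lemma Rintegral_tail a x f t : L1R `[a, x] f -> t \in `[a, x] ->
  \int[mu]_(s in `[t, x]) f s =
  \int[mu]_(s in `[a, x]) f s - \int[mu]_(s in `[a, t]) f s.
Proof.
move=> fi; rewrite in_itv/= => /andP[t0 tx].
rewrite -(@Rintegral_itv_obnd_cbnd _ t (BRight x)); last first.
  by apply: integrableS fi => //; apply: subset_itvr; rewrite bnd_simp.
by rewrite Rintegral_itvB// bnd_simp.
Qed.

Lemma L1R_upper a x f g : L1R `[a, x] f -> L1R `[a, x] g ->
  L1R `[a, x] (fun t => g t * \int[mu]_(s in `[t, x]) f s).
Proof.
move=> fi gi; pose c := \int[mu]_(s in `[a, x]) f s.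
have h : L1R `[a, x] (fun t => c * g t - g t * \int[mu]_(s in `[a, t]) f s).
  by apply: L1RB => //; [exact: L1RZl|exact: L1R_lower].
apply: (eq_L1R _ _ h) => // t /set_mem/= tx.
by rewrite (Rintegral_tail fi tx) mulrBr [c * _]mulrC.
Qed.

(** Both sides are the integral of [f s * g t] over the triangle
    [a <= t <= s <= x]. This exchange is the only form of Fubini's theorem used
    below; integration by parts, the powers in Gronwall's lemma and the second
    mean value theorem all come from it. *)
Lemma Rintegral_swap a x f g : L1R `[a, x] f -> L1R `[a, x] g ->
  \int[mu]_(s in `[a, x]) (f s * \int[mu]_(t in `[a, s]) g t) =
  \int[mu]_(t in `[a, x]) (g t * \int[mu]_(s in `[t, x]) f s).
Proof.
move=> fi gi; rewrite Rintegral_mkcond [RHS]Rintegral_mkcond /Rintegral.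
congr fine; transitivity (\int[mu]_s fubini_F mu (ker a x f g) s)%E.
  by apply: eq_integral => s _; rewrite ker_F.
transitivity (\int[mu]_t fubini_G mu (ker a x f g) t)%E; last first.
  by apply: eq_integral => s _; rewrite ker_G.
exact: (Fubini (integrable_ker fi gi)).
Qed.

End real_swap.

(** * Complex-valued integrals *)

Section cn1.
Context {R : realType}.
Implicit Types z w : R[i].

(** The l1 norm of the plane replaces the modulus in all estimates: it is
    submultiplicative, equivalent to the modulus, and bounds an integral taken
    componentwise with constant 1 (see [cn1_cint]), by the real inequality. *)
Definition cn1 z : R := `|complex.Re z| + `|complex.Im z|.

Lemma cReD z w : complex.Re (z + w) = complex.Re z + complex.Re w.
Proof. by case: z; case: w. Qed.

Lemma cImD z w : complex.Im (z + w) = complex.Im z + complex.Im w.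
Proof. by case: z; case: w. Qed.

Lemma cReN z : complex.Re (- z) = - complex.Re z.
Proof. by case: z. Qed.

Lemma cImN z : complex.Im (- z) = - complex.Im z.
Proof. by case: z. Qed.

Lemma cReM z w : complex.Re (z * w) =
  complex.Re z * complex.Re w - complex.Im z * complex.Im w.
Proof. by case: z; case: w. Qed.

Lemma cImM z w : complex.Im (z * w) =
  complex.Re z * complex.Im w + complex.Im z * complex.Re w.
Proof. by case: z => a b; case: w. Qed.

Lemma complexP z w : complex.Re z = complex.Re w ->
  complex.Im z = complex.Im w -> z = w.
Proof. by case: z => a b; case: w => c d /= -> ->. Qed.

Lemma cn1_ge0 z : 0 <= cn1 z.
Proof. by rewrite addr_ge0. Qed.

Lemma cn10 : cn1 0 = 0.
Proof. by rewrite /cn1/= normr0 addr0. Qed.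

Lemma cn1D z w : cn1 (z + w) <= cn1 z + cn1 w.
Proof.
rewrite /cn1 cReD cImD.
by rewrite (le_trans (lerD (ler_normD _ _) (ler_normD _ _)))// addrACA.
Qed.

Lemma cn1N z : cn1 (- z) = cn1 z.
Proof. by rewrite /cn1 cReN cImN !normrN. Qed.

Lemma cn1M z w : cn1 (z * w) <= cn1 z * cn1 w.
Proof.
rewrite /cn1 cReM cImM (le_trans (lerD (ler_normB _ _) (ler_normD _ _)))//.
by rewrite !normrM le_eqVlt; apply/orP; left; apply/eqP; ring.
Qed.

Lemma cn1_sum I (s : seq I) (P : pred I) (F : I -> R[i]) :
  cn1 (\sum_(i <- s | P i) F i) <= \sum_(i <- s | P i) cn1 (F i).
Proof.
elim/big_rec2 : _ => [|i x y _ h]; first by rewrite cn10.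
by rewrite (le_trans (cn1D _ _))// lerD2l.
Qed.

Lemma cabs_sqrt z : cabs z = Num.sqrt (complex.Re z ^+ 2 + complex.Im z ^+ 2).
Proof. by case: z. Qed.

Lemma cabs_ge0 z : 0 <= cabs z.
Proof. by rewrite cabs_sqrt sqrtr_ge0. Qed.

Lemma cabs_le_cn1 z : cabs z <= cn1 z.
Proof.
rewrite cabs_sqrt -(@ler_pXn2r _ 2) ?nnegrE ?sqrtr_ge0 ?cn1_ge0//.
rewrite sqr_sqrtr ?addr_ge0 ?sqr_ge0// /cn1 sqrrD !real_normK ?num_real//.
by rewrite lerD2r lerDl mulrn_wge0// mulr_ge0.
Qed.

Lemma cn1_le_cabs z : cn1 z <= 2 * cabs z.
Proof.
rewrite cabs_sqrt mulr_natl mulr2n lerD// -sqrtr_sqr ler_wsqrtr//.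
  by rewrite lerDl sqr_ge0.
by rewrite lerDr sqr_ge0.
Qed.

End cn1.

Section complex_integral.
Context {R : realType}.
Local Notation mu := (@lebesgue_measure R).
Implicit Types (f g : R -> R[i]) (a x : R) (D : set R).

Lemma L1_eq D f g : measurable D -> {in D, f =1 g} -> L1_on D f -> L1_on D g.
Proof.
move=> mD fg [fr fi]; split.
  by apply: (eq_L1R (f := fun t => complex.Re (f t))) => // t tD; rewrite fg.
by apply: (eq_L1R (f := fun t => complex.Im (f t))) => // t tD; rewrite fg.
Qed.

Lemma L1S (E D : set R) f : measurable E -> measurable D -> D `<=` E ->
  L1_on E f -> L1_on D f.
Proof. by move=> mE mD DE [? ?]; split; apply: (L1RS mE). Qed.

Lemma L1_itvS a b c d f : a <= c -> d <= b ->
  L1_on `[a, b] f -> L1_on `[c, d] f.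
Proof.
move=> ac db; apply: L1S => // t /=; rewrite !in_itv/= => /andP[ct td].
by rewrite (le_trans ac)//= (le_trans td).
Qed.

Lemma L1D D f g : measurable D -> L1_on D f -> L1_on D g ->
  L1_on D (fun t => f t + g t).
Proof.
move=> mD [? ?] [? ?]; split.
  apply: (eq_L1R (f := fun t => complex.Re (f t) + complex.Re (g t))) => //.
    by move=> t _; rewrite cReD.
  exact: L1RD.
apply: (eq_L1R (f := fun t => complex.Im (f t) + complex.Im (g t))) => //.
  by move=> t _; rewrite cImD.
exact: L1RD.
Qed.

Lemma L1M_split D f g : measurable D ->
  L1R D (fun t => complex.Re (f t) * complex.Re (g t)) ->
  L1R D (fun t => complex.Im (f t) * complex.Im (g t)) ->
  L1R D (fun t => complex.Re (f t) * complex.Im (g t)) ->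
  L1R D (fun t => complex.Im (f t) * complex.Re (g t)) ->
  L1_on D (fun t => f t * g t).
Proof.
move=> mD h1 h2 h3 h4; split.
  by apply: (eq_L1R _ _ (L1RB mD h1 h2)) => // t tD; rewrite cReM.
by apply: (eq_L1R _ _ (L1RD mD h3 h4)) => // t tD; rewrite cImM.
Qed.

Definition cmeasurable D f := measurable_fun D (fun t => complex.Re (f t)) /\
  measurable_fun D (fun t => complex.Im (f t)).

Lemma L1_cmeasurable D f : measurable D -> L1_on D f -> cmeasurable D f.
Proof.
move=> mD [h1 h2]; split; apply/measurable_EFinP.
  exact: measurable_int h1.
exact: measurable_int h2.
Qed.

Lemma cmeasurableM D f g : cmeasurable D f -> cmeasurable D g -> cmeasurable D (fun t => f t * g t).
Proof.
move=> [h1 h2] [h3 h4]; split.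
  rewrite (_ : (fun _ => _) = (fun t => complex.Re (f t) * complex.Re (g t)) \-
    (fun t => complex.Im (f t) * complex.Im (g t))).
    by apply: measurable_funB; apply: measurable_funM.
  by apply/funext => t /=; rewrite cReM.
rewrite (_ : (fun _ => _) = (fun t => complex.Re (f t) * complex.Im (g t)) \+
  (fun t => complex.Im (f t) * complex.Re (g t))).
  by apply: measurable_funD; apply: measurable_funM.
by apply/funext => t /=; rewrite cImM.
Qed.

Lemma cmeasurableD D f g : cmeasurable D f -> cmeasurable D g -> cmeasurable D (fun t => f t + g t).
Proof.
move=> [h1 h2] [h3 h4]; split.
  rewrite (_ : (fun _ => _) = (fun t => complex.Re (f t)) \+ (fun t => complex.Re (g t))).
    exact: measurable_funD.
  by apply/funext => t /=; rewrite cReD.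
rewrite (_ : (fun _ => _) = (fun t => complex.Im (f t)) \+ (fun t => complex.Im (g t))).
  exact: measurable_funD.
by apply/funext => t /=; rewrite cImD.
Qed.

Lemma cmeasurable_cst D c : cmeasurable D (fun=> c).
Proof. by split; exact: measurable_cst. Qed.

Lemma cmeasurable_eq D f g : {in D, f =1 g} -> cmeasurable D f -> cmeasurable D g.
Proof.
move=> fg [h1 h2]; split.
  by apply: (eq_measurable_fun (fun t => complex.Re (f t))) => // t tD; rewrite fg.
by apply: (eq_measurable_fun (fun t => complex.Im (f t))) => // t tD; rewrite fg.
Qed.

Lemma L1_bmul D (M : R) f g : measurable D -> cmeasurable D f ->
  (forall t, D t -> cn1 (f t) <= M) -> L1_on D g -> L1_on D (fun t => f t * g t).
Proof.
move=> mD [fr fi] fM [gr gi].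
have rM t : D t -> `|complex.Re (f t)| <= M.
  by move/fM; apply: le_trans; rewrite lerDl.
have iM t : D t -> `|complex.Im (f t)| <= M.
  by move/fM; apply: le_trans; rewrite lerDr.
by apply: L1M_split => //; apply: (L1R_bmul (M := M)).
Qed.

Lemma L1_bmulr D (M : R) f g : measurable D -> cmeasurable D g ->
  (forall t, D t -> cn1 (g t) <= M) -> L1_on D f -> L1_on D (fun t => f t * g t).
Proof.
move=> mD mg gM fi; apply: (L1_eq (f := fun t => g t * f t)) => //.
  by move=> t _; rewrite mulrC.
exact: (L1_bmul (M := M)).
Qed.

Lemma L1Zl D c f : measurable D -> L1_on D f -> L1_on D (fun t => c * f t).
Proof. by move=> mD fi; apply: (@L1_bmul _ (cn1 c)) => //; exact: cmeasurable_cst. Qed.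

Lemma L1N D f : measurable D -> L1_on D f -> L1_on D (fun t => - f t).
Proof.
by move=> mD /(L1Zl (-1) mD); apply: L1_eq => // t _; rewrite mulN1r.
Qed.

Lemma L1B D f g : measurable D -> L1_on D f -> L1_on D g ->
  L1_on D (fun t => f t - g t).
Proof. by move=> mD fi gi; apply: L1D => //; exact: L1N. Qed.

Lemma L1_0 D : measurable D -> L1_on D (fun=> 0).
Proof. by move=> mD; split; exact: integrable0. Qed.

Lemma L1_sum D I (s : seq I) (F : I -> R -> R[i]) : measurable D ->
  (forall i, L1_on D (F i)) -> L1_on D (fun t => \sum_(i <- s) F i t).
Proof.
move=> mD h; elim: s => [|i s IH].
  by apply: (L1_eq _ _ (L1_0 mD)) => // t _; rewrite big_nil.
by apply: (L1_eq _ _ (L1D mD (h i) IH)) => // t _; rewrite big_cons.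
Qed.

Lemma L1_cn1 D f : measurable D -> L1_on D f -> L1R D (fun t => cn1 (f t)).
Proof. by move=> mD [h1 h2]; apply: L1RD => //; apply: L1R_norm. Qed.

Lemma eq_cint D f g : {in D, f =1 g} -> cint D f = cint D g.
Proof.
by move=> fg; rewrite /cint; congr Complex; apply: eq_Rintegral => t tD; rewrite fg.
Qed.

Lemma cintD D f g : measurable D -> L1_on D f -> L1_on D g ->
  cint D (fun t => f t + g t) = cint D f + cint D g.
Proof.
move=> mD [fr fi] [gr gi]; rewrite /cint.
under eq_Rintegral do rewrite cReD.
under [X in Complex _ X]eq_Rintegral do rewrite cImD.
by rewrite !RintegralD.
Qed.

Lemma cintM_split D f g :  measurable D ->
  L1R D (fun t => complex.Re (f t) * complex.Re (g t)) ->
  L1R D (fun t => complex.Im (f t) * complex.Im (g t)) ->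
  L1R D (fun t => complex.Re (f t) * complex.Im (g t)) ->
  L1R D (fun t => complex.Im (f t) * complex.Re (g t)) ->
  cint D (fun t => f t * g t) =
  Complex (\int[mu]_(t in D) (complex.Re (f t) * complex.Re (g t)) -
           \int[mu]_(t in D) (complex.Im (f t) * complex.Im (g t)))
          (\int[mu]_(t in D) (complex.Re (f t) * complex.Im (g t)) +
           \int[mu]_(t in D) (complex.Im (f t) * complex.Re (g t))).
Proof.
move=> mD h1 h2 h3 h4; rewrite -RintegralB// -RintegralD// /cint.
by congr Complex; apply: eq_Rintegral => t _; rewrite ?cReM ?cImM.
Qed.

Lemma cintZl D c f : measurable D -> L1_on D f ->
  cint D (fun t => c * f t) = c * cint D f.
Proof.
move=> mD [fr fi]; rewrite cintM_split//; try exact: L1RZl.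
by rewrite !RintegralZl//; case: c.
Qed.

Lemma cintB D f g : measurable D -> L1_on D f -> L1_on D g ->
  cint D (fun t => f t - g t) = cint D f - cint D g.
Proof.
move=> mD fi gi; rewrite cintD//; last exact: L1N.
congr (_ + _); rewrite -mulN1r -cintZl//.
by apply: eq_cint => t _; rewrite mulN1r.
Qed.

Lemma cint0 D : cint D (fun=> 0) = 0 :> R[i].
Proof. by rewrite /cint; congr Complex; rewrite /Rintegral/= integral0. Qed.

Lemma cint_sum D I (s : seq I) (F : I -> R -> R[i]) : measurable D ->
  (forall i, L1_on D (F i)) ->
  cint D (fun t => \sum_(i <- s) F i t) = \sum_(i <- s) cint D (F i).
Proof.
move=> mD h; elim: s => [|i s IH].
  rewrite big_nil -[RHS](cint0 D); apply: eq_cint => t _; by rewrite big_nil.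
rewrite big_cons -IH -cintD//; last exact: L1_sum.
by apply: eq_cint => t _; rewrite big_cons.
Qed.

Lemma cn1_cint D f : measurable D -> L1_on D f ->
  cn1 (cint D f) <= \int[mu]_(t in D) cn1 (f t).
Proof.
move=> mD [h1 h2]; rewrite /cn1 RintegralD//; try exact: L1R_norm.
by rewrite lerD// le_normr_Rintegral.
Qed.

Lemma cint_set1 f x : cint `[x, x] f = 0.
Proof. by rewrite set_itv1 /cint !Rintegral_set1. Qed.

Lemma cint_tail a x f t : L1_on `[a, x] f -> t \in `[a, x] ->
  cint `[t, x] f = cint `[a, x] f - cint `[a, t] f.
Proof.
move=> [h1 h2] tx; rewrite /cint (Rintegral_tail h1 tx) (Rintegral_tail h2 tx).
by apply: complexP; rewrite ?(cReD, cImD, cReN, cImN).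
Qed.

Lemma cint_swap a x f g : L1_on `[a, x] f -> L1_on `[a, x] g ->
  cint `[a, x] (fun s => f s * cint `[a, s] g) =
  cint `[a, x] (fun t => g t * cint `[t, x] f).
Proof.
move=> [fr fi] [gr gi].
have mx := measurable_itv `[a, x].
rewrite (@cintM_split _ f (fun s => cint `[a, s] g) mx (L1R_lower fr gr)
  (L1R_lower fi gi) (L1R_lower fr gi) (L1R_lower fi gr)).
rewrite (@cintM_split _ g (fun t => cint `[t, x] f) mx (L1R_upper fr gr)
  (L1R_upper fi gi) (L1R_upper fi gr) (L1R_upper fr gi)).
have h1 := Rintegral_swap fr gr; have h2 := Rintegral_swap fi gi.
have h3 := Rintegral_swap fr gi; have h4 := Rintegral_swap fi gr.
apply: complexP => /=; first by rewrite h1 h2.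
by rewrite h3 h4 addrC.
Qed.

Lemma L1_lower a x f g : L1_on `[a, x] f -> L1_on `[a, x] g ->
  L1_on `[a, x] (fun s => f s * cint `[a, s] g).
Proof.
move=> [fr fi] [gr gi]; have mx := measurable_itv `[a, x].
exact: (@L1M_split _ f (fun s => cint `[a, s] g) mx (L1R_lower fr gr)
  (L1R_lower fi gi) (L1R_lower fr gi) (L1R_lower fi gr)).
Qed.

Lemma L1_upper a x f g : L1_on `[a, x] f -> L1_on `[a, x] g ->
  L1_on `[a, x] (fun t => g t * cint `[t, x] f).
Proof.
move=> [fr fi] [gr gi]; have mx := measurable_itv `[a, x].
exact: (@L1M_split _ g (fun t => cint `[t, x] f) mx (L1R_upper fr gr)
  (L1R_upper fi gi) (L1R_upper fi gr) (L1R_upper fr gi)).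
Qed.

(** Indefinite integrals are continuous, hence measurable. *)
Lemma cmeasurable_cint a x f : L1_on `[a, x] f -> cmeasurable `[a, x] (fun s => cint `[a, s] f).
Proof.
have [x0|x0 _] := leP a x; last first.
  by rewrite set_itv_ge ?bnd_simp -?ltNge//; split; exact: measurable_fun_set0.
by move=> [h1 h2]; split; apply: subspace_continuous_measurable_fun => //;
  exact: parameterized_integral_continuous.
Qed.

Lemma cn1_cint_le a x t f : L1_on `[a, x] f -> t \in `[a, x] ->
  cn1 (cint `[a, t] f) <= \int[mu]_(s in `[a, x]) cn1 (f s).
Proof.
move=> fi; rewrite in_itv/= => /andP[t0 tx].
have fti : L1_on `[a, t] f by apply: L1_itvS fi.
rewrite (le_trans (cn1_cint _ fti))//.
rewrite -subr_ge0 Rintegral_itvB ?bnd_simp//; last exact: L1_cn1.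
by apply: Rintegral_ge0 => s _; exact: cn1_ge0.
Qed.

Lemma cint_ae D f g : measurable D -> L1_on D f -> L1_on D g ->
  {ae mu, forall t, D t -> f t = g t} -> cint D f = cint D g.
Proof.
move=> mD [fr fi] [gr gi] fg; rewrite /cint /Rintegral; congr (Complex (fine _) (fine _)).
  apply: ae_eq_integral => //; [exact: measurable_int fr|exact: measurable_int gr|].
  case: fg => N [mN N0 sub]; exists N; split => //; apply: subset_trans sub => t /=.
  by apply: contra_not => h Dt; rewrite h.
apply: ae_eq_integral => //; [exact: measurable_int fi|exact: measurable_int gi|].
case: fg => N [mN N0 sub]; exists N; split => //; apply: subset_trans sub => t /=.
by apply: contra_not => h Dt; rewrite h.
Qed.

End complex_integral.

(** * Exponential waves *)

Section real_ftc.
Context {R : realType}.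
Local Notation mu := (@lebesgue_measure R).

Lemma Rintegral_is_derive (F f : R -> R) (a x : R) : a <= x ->
  (forall t, is_derive t (1 : R) F (f t)) -> continuous f ->
  \int[mu]_(t in `[a, x]) f t = F x - F a.
Proof.
rewrite le_eqVlt => /predU1P[<- _ _|x0 dF cf].
  by rewrite set_itv1 Rintegral_set1 subrr.
have cF t : {for t, continuous F}.
  by apply: differentiable_continuous; apply/derivable1_diffP; have [] := dF t.
rewrite /Rintegral (@continuous_FTC2 _ f F a x)//.
- by apply: continuous_subspaceT => t; exact: cf.
- split.
  + by move=> t _; have [] := dF t.
  + by apply: cvg_at_right_filter; exact: cF.
  + by apply: cvg_at_left_filter; exact: cF.
- by move=> t _; rewrite derive1E; have [_ ->] := dF t.
Qed.

End real_ftc.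

Section wave.
Context {R : realType}.
Local Notation C := R[i].
Implicit Types (lam : C) (s t : R).

(** The phases of the statement are [wave lam (a * t)] (see [cphase_wave]); with
    the speed absorbed in the argument, the group law is [waveD]. *)
Definition wave lam t : C := cexp ('i%C * lam * t%:C%C).

Lemma waveE lam t : wave lam t =
  Complex (expR (- complex.Im lam * t) * cos (complex.Re lam * t))
          (expR (- complex.Im lam * t) * sin (complex.Re lam * t)).
Proof.
by rewrite /wave /cexp; case: lam => p q /=;
  rewrite !(mul0r, mul1r, mulr0, subr0, add0r, sub0r).
Qed.

Lemma cphase_wave a lam t : cphase a lam t = wave lam (a * t).
Proof. by rewrite /cphase /wave rmorphM/=; congr cexp; ring. Qed.

Lemma cexpD (z w : C) : cexp (z + w) = cexp z * cexp w.
Proof.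
rewrite /cexp cReD cImD expRD cosD sinD; apply: complexP; rewrite ?cReM ?cImM/=; ring.
Qed.

Lemma waveD lam s t : wave lam (s + t) = wave lam s * wave lam t.
Proof. by rewrite /wave rmorphD/= mulrDr cexpD. Qed.

Lemma wave0 lam : wave lam 0 = 1.
Proof. by rewrite waveE !mulr0 expR0 cos0 sin0 mulr0 mulr1. Qed.

Lemma waveNK lam t : wave lam t * wave lam (- t) = 1.
Proof. by rewrite -waveD subrr wave0. Qed.

(** Moving the spectral parameter along the imaginary axis multiplies the wave
    by a real exponential. Finite combinations of such shifts therefore weight a
    wave by any polynomial in that exponential. *)
Lemma wave_shift lam m t :
  wave (lam - 'i%C * m%:C%C) t = wave lam t * (expR (m * t))%:C%C.
Proof.
rewrite !waveE; apply: complexP; rewrite ?cReM ?cImM/= ?(cReD, cImD, cReN, cImN, cReM, cImM)/=.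
  rewrite !(mul0r, mul1r, mulr0, subr0, addr0, oppr0, sub0r, add0r).
  by rewrite opprB mulrDl expRD; ring.
rewrite !(mul0r, mul1r, mulr0, subr0, addr0, oppr0, sub0r, add0r).
by rewrite opprB mulrDl expRD; ring.
Qed.

Lemma cn1_wave lam t : cn1 (wave lam t) <= 2 * expR (`|complex.Im lam| * `|t|).
Proof.
rewrite waveE /cn1 /= !normrM -mulrDr mulrC ler_pM ?addr_ge0//.
  rewrite [leRHS](_ : 2 = 1 + 1)// lerD// ler_norml ?cos_geN1 ?cos_le1 ?sin_geN1 ?sin_le1//.
by rewrite ger0_norm ?expR_ge0// ler_expR -normrM -normrN -mulNr ler_norm.
Qed.

Lemma is_derive_wave b lam t :
  is_derive t (1 : R) (fun t => complex.Re (wave lam (b * t)))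
     (complex.Re ('i%C * lam * b%:C%C * wave lam (b * t))) /\
  is_derive t (1 : R) (fun t => complex.Im (wave lam (b * t)))
     (complex.Im ('i%C * lam * b%:C%C * wave lam (b * t))).
Proof.
pose p := complex.Re lam * b; pose q := - complex.Im lam * b.
have -> : (fun t => complex.Re (wave lam (b * t))) = (fun t => expR (q * t) * cos (p * t)).
  by apply/funext => u; rewrite waveE/= !mulrA.
have -> : (fun t => complex.Im (wave lam (b * t))) = (fun t => expR (q * t) * sin (p * t)).
  by apply/funext => u; rewrite waveE/= !mulrA.
have dq : is_derive t (1 : R) (fun t => expR (q * t)) (expR (q * t) * q).
  apply: (is_derive_eq (is_derive1_comp (f := expR) (g := fun t => q * t) _ _)).
  by rewrite /GRing.scale/= mulr1.
have dp1 : is_derive t (1 : R) (fun t => cos (p * t)) (- sin (p * t) * p).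
  by apply: (is_derive_eq (is_derive1_comp (f := cos) (g := fun t => p * t) _ _)); rewrite /GRing.scale/= mulr1.
have dp2 : is_derive t (1 : R) (fun t => sin (p * t)) (cos (p * t) * p).
  by apply: (is_derive_eq (is_derive1_comp (f := sin) (g := fun t => p * t) _ _)); rewrite /GRing.scale/= mulr1.
split.
  apply: (is_derive_eq (is_deriveM dq dp1)).
  by rewrite waveE ?(cReM, cImM)/= /GRing.scale/= !mulrA -/p -/q /p /q; ring.
apply: (is_derive_eq (is_deriveM dq dp2)).
by rewrite waveE ?(cReM, cImM)/= /GRing.scale/= !mulrA -/p -/q /p /q; ring.
Qed.

Lemma continuous_wave b lam :
  continuous (fun t => complex.Re (wave lam (b * t))) /\
  continuous (fun t => complex.Im (wave lam (b * t))).
Proof.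
by split => t; apply: differentiable_continuous; apply/derivable1_diffP;
  have [[? _] [? _]] := is_derive_wave b lam t.
Qed.

Lemma cmeasurable_wave b lam (D : set R) : cmeasurable D (fun t => wave lam (b * t)).
Proof.
have [c1 c2] := continuous_wave b lam.
by split; apply: (measurable_funS measurableT (@subsetT _ D));
  exact: continuous_measurable_fun.
Qed.

End wave.

(** * Gronwall's inequality *)

Section gronwall.
Context {R : realType}.
Local Notation mu := (@lebesgue_measure R).
Variables (q : R -> R) (X : R).
Hypothesis q_ge0 : forall t, 0 <= q t.
Hypothesis qi : L1R `[0, X] q.

Let Q s := \int[mu]_(t in `[0, s]) q t.
(** The iterates of the constant 1 under [M |-> int_0^s q M]; their sum is the
    exponential of [Q]. *)
Let e n s := Q s ^+ n / n`!%:R.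

Let qiS x : x <= X -> L1R `[0, x] q.
Proof. by move=> xX; apply: L1RS qi => // t /=; rewrite !in_itv/= => /andP[->/=/le_trans]; exact. Qed.

Let int_e n x : x <= X ->
  L1R `[0, x] (fun s => q s * e n s) /\
  \int[mu]_(s in `[0, x]) (q s * e n s) = e n.+1 x.
Proof.
elim: n x => [|n IH] x xX.
  have h : (fun s => q s * e 0 s) = q.
    by apply/funext => s; rewrite /e expr0 fact0 divr1 mulr1.
  by rewrite h /e expr1 divr1; split => //; exact: qiS.
have [ei1 ei2] := IH x xX.
have eE s : s \in `[0, x]%classic -> q s * \int[mu]_(t in `[0, s]) (q t * e n t) = q s * e n.+1 s.
  move=> /set_mem/=; rewrite in_itv/= => /andP[_ sx].
  by have [_ ->] := IH s (le_trans sx xX).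
have L := L1R_lower (qiS xX) ei1.
have L' : L1R `[0, x] (fun s => q s * e n.+1 s) by exact: (eq_L1R _ eE L).
split=> //.
(* Exchanging the order of integration expresses the integral through itself,
   and the resulting linear equation is solved for it. *)
have E1 : \int[mu]_(s in `[0, x]) (q s * e n.+1 s) =
    Q x * e n.+1 x - n.+1%:R * \int[mu]_(s in `[0, x]) (q s * e n.+1 s).
  rewrite -{1}(eq_Rintegral mu eE) (Rintegral_swap (qiS xX) ei1).
  rewrite -ei2 -[X in X - _]RintegralZl// -[X in _ - X]RintegralZl//.
  rewrite -RintegralB//; [|exact: L1RZl|exact: L1RZl].
  apply: eq_Rintegral => t /set_mem/= tx.
  rewrite (Rintegral_tail (qiS xX) tx) -/(Q x) -/(Q t) mulrBr mulrC; congr (_ - _).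
  rewrite /e factS natrM exprS.
  by field; rewrite nat1r !pnatr_eq0 -!lt0n fact_gt0.
have n0 : (n.+2)%:R != 0 :> R by rewrite pnatr_eq0.
apply: (mulfI n0); rewrite -[n.+2]addn1 natrD mulrDl mul1r {2}E1 addrC subrK.
rewrite /e addn1 [n.+2`!]factS [(n.+2 * _)%N%:R]natrM [Q x ^+ n.+2]exprS.
by field; rewrite -natrD !pnatr_eq0 -!lt0n fact_gt0.
Qed.

Let S n s := \sum_(k < n) e k s.

Let int_S n x : x <= X ->
  L1R `[0, x] (fun s => q s * S n s) /\
  1 + \int[mu]_(s in `[0, x]) (q s * S n s) = S n.+1 x.
Proof.
move=> xX; elim: n => [|n [IH1 IH2]].
  rewrite (_ : (fun s => q s * S 0 s) = fun=> 0).
    split; first exact: integrable0.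
    by rewrite /S big_ord1 /e expr0 fact0 divr1 /Rintegral integral0 addr0.
  by apply/funext => s; rewrite /S big_ord0 mulr0.
rewrite (_ : (fun s => q s * S n.+1 s) = fun s => q s * S n s + q s * e n s); last first.
  by apply/funext => s; rewrite /S big_ord_recr/= mulrDr.
have [e1 e2] := int_e n xX.
split; first exact: L1RD.
by rewrite RintegralD// addrA IH2 e2 /S [RHS]big_ord_recr.
Qed.

Let Q_ge0 s : 0 <= Q s.
Proof. by apply: Rintegral_ge0 => t _. Qed.

(** Gronwall's inequality for a family of values [V s c], meaning that the value
    [c] occurs at the point [s]. The supremum of the values at a point need not be
    a measurable function of the point, so the integral inequality is required
    against every integrable majorant [M]. Starting from the constant majorant
    [M0], each application improves the majorant by one term of the exponential
    series, and the contribution of [M0] is [M0 * Q ^ n / n!], which tends to 0. *)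
Lemma gronwall (V : R -> R -> Prop) (M0 A rho : R) :
  (forall s c, s \in `[0, X] -> V s c -> c <= M0) ->
  (forall M : R -> R, L1R `[0, X] (fun s => q s * M s) ->
    (forall s c, s \in `[0, X] -> V s c -> c <= M s) ->
    forall x c, x \in `[0, X] -> V x c ->
      c <= A + \int[mu]_(s in `[0, x]) (q s * M s)) ->
  0 <= A -> Q X <= rho ->
  forall x c, x \in `[0, X] -> V x c -> c <= A * expR rho.
Proof.
move=> V0 VS A0 Qrho x c xX Vc.
have key n : forall s c, s \in `[0, X] -> V s c -> c <= A * S n s + M0 * e n s.
  elim: n => [s d sX Vd|n IH s d sX Vd].
    by rewrite /S big_ord0 mulr0 add0r /e expr0 fact0 divr1 mulr1 (V0 s).
  have sX' : s <= X by move: sX; rewrite in_itv => /andP[].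
  have [S1 _] := int_S n (lexx X); have [e1 _] := int_e n (lexx X).
  have [S1' S2] := int_S n sX'; have [e1' e2] := int_e n sX'.
  have E : (fun t => q t * (A * S n t + M0 * e n t)) =
           (fun t => A * (q t * S n t) + M0 * (q t * e n t)).
    by apply/funext => t; ring.
  have := VS (fun t => A * S n t + M0 * e n t) _ IH s d sX Vd.
  rewrite E => /(_ _)/le_trans; apply.
    by apply: L1RD => //; exact: L1RZl.
  rewrite RintegralD//; [|exact: L1RZl|exact: L1RZl].
  by rewrite !RintegralZl// e2 -S2 addrA mulrDr mulr1.
have Qx : Q x <= rho.
  have /andP[x0 xX'] : 0 <= x <= X by move: xX; rewrite in_itv.
  apply: le_trans Qrho; rewrite /Q -subr_ge0 Rintegral_itvB ?bnd_simp//.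
  by apply: Rintegral_ge0 => t _.
have rho0 : 0 <= rho by apply: le_trans Qx.
have Sle n : S n x <= expR rho.
  apply: (@le_trans _ _ (series (exp_coeff rho) n)).
    rewrite /series/= big_mkord; apply: ler_sum => i _.
    by rewrite /e /exp_coeff/= ler_wpM2r ?invr_ge0// lerXn2r ?nnegrE.
  rewrite /expR; apply: nondecreasing_cvgn_le; last exact: is_cvg_series_exp_coeff.
  apply/nondecreasing_seqP => i; rewrite /series/= big_nat_recr//= lerDl.
  exact: exp_coeff_ge0.
pose u n := A * expR rho + `|M0| * exp_coeff rho n.
have cu n : c <= u n.
  rewrite (le_trans (key n x c xX Vc))// lerD//; first by rewrite ler_wpM2l.
  have e0 : 0 <= e n x by rewrite /e divr_ge0// exprn_ge0.
  apply: (@le_trans _ _ (`|M0| * e n x)); first by rewrite ler_wpM2r// ler_norm.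
  rewrite ler_wpM2l// /e /exp_coeff/= ler_wpM2r ?invr_ge0// lerXn2r ?nnegrE//.
have ul : u @ \oo --> A * expR rho + `|M0| * 0.
  apply: cvgD; first exact: cvg_cst.
  by apply: cvgMr; exact: cvg_exp_coeff.
rewrite -[leRHS]addr0 -[X in _ + X](mulr0 `|M0|) -(cvg_lim (@Rhausdorff R) ul).
apply: limr_ge; first by apply/cvg_ex; eexists; exact: ul.
by near=> n; exact: cu.
Unshelve. all: by end_near. Qed.

End gronwall.

(** * Integration by parts and Duhamel's formula *)

Section calculus.
Context {R : realType}.
Local Notation mu := (@lebesgue_measure R).
Local Notation C := R[i].
Implicit Types (f g F G : R -> C) (a x : R) (lam : C).

(** Integration by parts for absolutely continuous functions: the product of the
    two indefinite integrals is an integral over a square, which the diagonal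
    cuts into two triangles. *)
Lemma cint_product a x f g F G : a <= x ->
  L1_on `[a, x] f -> L1_on `[a, x] g ->
  (forall t, t \in `[a, x] -> F t = F a + cint `[a, t] f) ->
  (forall t, t \in `[a, x] -> G t = G a + cint `[a, t] g) ->
  F x * G x = F a * G a + cint `[a, x] (fun t => f t * G t + F t * g t).
Proof.
move=> ax fi gi FE GE; have mx := measurable_itv `[a, x].
have xx : x \in `[a, x] by rewrite in_itv/= ax lexx.
have fG : L1_on `[a, x] (fun t => G a * f t + f t * cint `[a, t] g).
  by apply: L1D => //; [exact: L1Zl|exact: L1_lower].
have Fg : L1_on `[a, x] (fun t => F a * g t + g t * cint `[a, t] f).
  by apply: L1D => //; [exact: L1Zl|exact: L1_lower].
rewrite (@eq_cint _ _ _ (fun t => (G a * f t + f t * cint `[a, t] g) +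
    (F a * g t + g t * cint `[a, t] f))); last first.
  by move=> t /set_mem/= tx; rewrite (GE _ tx) (FE _ tx); ring.
rewrite cintD// (cintD mx (L1Zl (G a) mx fi) (L1_lower fi gi)).
rewrite (cintD mx (L1Zl (F a) mx gi) (L1_lower gi fi)) !cintZl//.
rewrite cint_swap//.
rewrite (@eq_cint _ _ (fun t => g t * cint `[t, x] f)
  (fun t => cint `[a, x] f * g t - g t * cint `[a, t] f)); last first.
  by move=> t /set_mem/= tx; rewrite (cint_tail fi tx); ring.
rewrite (cintB mx (L1Zl _ mx gi) (L1_lower gi fi)) cintZl//.
by rewrite (FE _ xx) (GE _ xx); ring.
Qed.

Lemma L1_continuous a x f : continuous (fun t => complex.Re (f t)) ->
  continuous (fun t => complex.Im (f t)) -> L1_on `[a, x] f.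
Proof.
move=> c1 c2; split; apply: continuous_compact_integrable;
  (try exact: segment_compact); by apply: continuous_subspaceT.
Qed.

Lemma L1_wave b lam a x : L1_on `[a, x] (fun t => wave lam (b * t)).
Proof. by have [c1 c2] := continuous_wave b lam; exact: L1_continuous. Qed.

Lemma wave_ftc b lam a x : a <= x -> wave lam (b * x) =
  wave lam (b * a) + cint `[a, x] (fun t => 'i%C * lam * b%:C%C * wave lam (b * t)).
Proof.
move=> ax; pose d : C := 'i%C * lam * b%:C%C.
have [c1 c2] := continuous_wave b lam.
have cRe : continuous (fun t => complex.Re (d * wave lam (b * t))).
  rewrite (_ : (fun _ => _) = fun t => complex.Re d * complex.Re (wave lam (b * t)) -
     complex.Im d * complex.Im (wave lam (b * t))); last by apply/funext => t; rewrite cReM.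
  by move=> t; apply: cvgB; apply: cvgMr; [exact: c1|exact: c2].
have cIm : continuous (fun t => complex.Im (d * wave lam (b * t))).
  rewrite (_ : (fun _ => _) = fun t => complex.Re d * complex.Im (wave lam (b * t)) +
     complex.Im d * complex.Re (wave lam (b * t))); last by apply/funext => t; rewrite cImM.
  by move=> t; apply: cvgD; apply: cvgMr; [exact: c2|exact: c1].
have h1 := Rintegral_is_derive ax (fun t => (is_derive_wave b lam t).1) cRe.
have h2 := Rintegral_is_derive ax (fun t => (is_derive_wave b lam t).2) cIm.
apply: complexP; rewrite ?cReD ?cImD /cint [X in _ = _ + X]/=.
  by rewrite h1 addrC subrK.
by rewrite h2 addrC subrK.
Qed.

(** The second mean value theorem, in the form of a bound: with
    [w t = w a + int_a^t w'], exchanging the integrals replaces [f] by its tails,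
    and the total variation of [w] is at most 1 because [w'] has a constant
    sign. *)
Lemma cn1_cint_monotone a x f (w w' : R -> R) (S : R) : a <= x ->
  L1_on `[a, x] f ->
  (forall t, is_derive t (1:R) w (w' t)) -> continuous w' ->
  (forall t, t \in `[a, x] -> 0 <= w t <= 1) ->
  (forall t, t \in `[a, x] -> 0 <= w' t) \/
    (forall t, t \in `[a, x] -> w' t <= 0) ->
  (forall t, t \in `[a, x] -> cn1 (cint `[t, x] f) <= S) ->
  cn1 (cint `[a, x] (fun t => f t * (w t)%:C%C)) <= 2 * S.
Proof.
move=> ax fi dw cw' w01 w'm fS; have mx := measurable_itv `[a, x].
have aa : a \in `[a, x] by rewrite in_itv/= ax lexx.
have xx : x \in `[a, x] by rewrite in_itv/= ax lexx.
have S0 : 0 <= S by apply: le_trans (fS a aa); exact: cn1_ge0.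
pose g t : C := (w' t)%:C%C.
have gi : L1_on `[a, x] g.
  apply: L1_continuous; rewrite /g/=; first exact: cw'.
  by move=> t; exact: cvg_cst.
have wE t : t \in `[a, x] -> (w t)%:C%C = (w a)%:C%C + cint `[a, t] g.
  rewrite in_itv/= => /andP[at0 tx].
  apply: complexP; rewrite ?cReD ?cImD /cint/=.
    by rewrite (Rintegral_is_derive at0 dw cw') addrC subrK.
  by rewrite add0r /Rintegral integral0.
rewrite (@eq_cint _ _ _ (fun t => (w a)%:C%C * f t + f t * cint `[a, t] g)); last first.
  by move=> t /set_mem/= tx; rewrite (wE _ tx) mulrDr [f t * _]mulrC.
rewrite (cintD mx (L1Zl _ mx fi) (L1_lower fi gi)) cintZl// cint_swap//.
rewrite (le_trans (cn1D _ _))// mulr_natl mulr2n lerD//.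
  rewrite (le_trans (cn1M _ _))// {1}/cn1/= normr0 addr0.
  have /andP[wa0 wa1] := w01 a aa.
  rewrite ger0_norm// (le_trans (ler_wpM2l wa0 (fS a aa)))//.
  by rewrite ler_piMl.
rewrite (le_trans (cn1_cint mx (L1_upper fi gi)))//.
have nw : \int[mu]_(t in `[a, x]) `|w' t| <= 1.
  have /andP[wa0 wa1] := w01 a aa; have /andP[wx0 wx1] := w01 x xx.
  have iw := Rintegral_is_derive ax dw cw'.
  case: w'm => w'm.
    rewrite (@eq_Rintegral _ _ _ mu _ w'); last first.
      by move=> t /set_mem/= tx; rewrite ger0_norm// w'm.
    by rewrite iw; lra.
  rewrite (@eq_Rintegral _ _ _ mu _ (fun t => (- 1) * w' t)); last first.
    by move=> t /set_mem/= tx; rewrite ler0_norm// ?w'm// mulN1r.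
  by rewrite RintegralZl//; [rewrite iw; lra|exact: gi.1].
apply: (@le_trans _ _ (\int[mu]_(t in `[a, x]) (S * `|w' t|))).
  apply: le_Rintegral => //.
  - by apply: L1_cn1 => //; exact: L1_upper.
  - by apply: L1RZl => //; apply: L1R_norm => //; exact: gi.1.
  - move=> t tx; rewrite (le_trans (cn1M _ _))// mulrC ler_pM ?cn1_ge0 ?fS//.
    by rewrite /cn1/= normr0 addr0.
rewrite RintegralZl//; last by apply: L1R_norm => //; exact: gi.1.
by rewrite ler_piMr.
Qed.

End calculus.

Section duhamel.
Context {R : realType}.
Local Notation mu := (@lebesgue_measure R).
Local Notation C := R[i].
Variables (b1 b2 : R).
Hypotheses (hb1 : b1 < 0) (hb2 : 0 < b2).
Local Notation b := (bcoef b1 b2).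

(** The sums over the two components are always split at a given index [j],
    since only the entries off the diagonal couple the components. *)
Lemma sum_ord2 (V : nmodType) (j : 'I_2) (F : 'I_2 -> V) :
  \sum_(k < 2) F k = F j + F (rev_ord j).
Proof.
rewrite big_ord_recl big_ord_recl big_ord0 addr0; case: j => -[|[|//]] jl.
  by congr (F _ + F _); apply: val_inj.
by rewrite addrC; congr (F _ + F _); apply: val_inj.
Qed.

Lemma bcoef_neq0 j : b j != 0.
Proof. by rewrite /bcoef; case: ifP => _; [rewrite lt_eqF|rewrite gt_eqF]. Qed.

Lemma dirac_derivative (Q : 'M[C]_2) (lam : C) (y dy : 'cV[C]_2) (j : 'I_2) :
  Q j j = 0 ->
  - 'i%C *: (invmx (Bmx b1 b2) *m dy) + Q *m y = lam *: y ->
  dy j ord0 = 'i%C * lam * (b j)%:C%C * y j ord0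
    - 'i%C * (b j)%:C%C * (Q j (rev_ord j) * y (rev_ord j) ord0).
Proof.
move=> Qj e; have BV : Bmx b1 b2 \in unitmx.
  apply: (proj1 (@mulmx1_unit _ _ _ (diag_mx (\row_k (((b k)^-1)%:C)%C)) _)).
  rewrite /Bmx mulmx_diag -diag_const_mx; congr diag_mx; apply/rowP => k.
  by rewrite !mxE -rmorphM/= divff ?bcoef_neq0.
have := congr1 (fun v => ('i%C *: (Bmx b1 b2 *m v)) j ord0) e.
rewrite mulmxDr -scalemxAr mulKVmx// scalerDr scalerA mulrN.
rewrite [X in (X *: dy)](_ : _ = 1); last by rewrite -expr2 sqr_i opprK.
rewrite scale1r -scalemxAr /Bmx !mul_diag_mx !mxE (sum_ord2 j) Qj mul0r add0r => E.
by rewrite -[LHS](addrK ('i%C * ((b j)%:C%C * (Q j (rev_ord j) * y (rev_ord j) ord0)))) E; ring.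
Qed.

Lemma dirac_bounded (Q : R -> 'M[C]_2) (lam : C) (y : R -> 'cV[C]_2) (j : 'I_2) :
  dirac_solution b1 b2 Q lam y ->
  cmeasurable `[0, 1] (fun s => y s j ord0) /\
  exists M, forall s, s \in `[0, 1] -> cn1 (y s j ord0) <= M.
Proof.
move=> [dy [/(_ j)[di yE] _]]; split.
  apply: (cmeasurable_eq (f := fun s => y 0 j ord0 + cint `[0, s] (fun t => dy t j ord0))).
    by move=> s /set_mem/= s1; rewrite -yE.
  by apply: cmeasurableD; [exact: cmeasurable_cst|exact: cmeasurable_cint].
exists (cn1 (y 0 j ord0) + \int[mu]_(s in `[0, 1]) cn1 (dy s j ord0)) => s s1.
by rewrite (yE _ s1) (le_trans (cn1D _ _))// lerD2l cn1_cint_le.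
Qed.

Lemma L1_potential (Q : R -> 'M[C]_2) (lam : C) (y : R -> 'cV[C]_2) (j k : 'I_2) :
  potential Q -> dirac_solution b1 b2 Q lam y ->
  L1_on `[0, 1] (fun s => Q s j k * y s k ord0).
Proof.
move=> [_ Qi] /(dirac_bounded k)[my [M yM]].
by apply: (L1_bmulr (M := M)).
Qed.

Lemma L1_wavemul (lam : C) (a x c : R) (f : R -> C) :
  L1_on `[a, x] f -> L1_on `[a, x] (fun s => wave lam (c * s) * f s).
Proof.
move=> fi; pose M := `|c| * (`|a| + `|x|).
apply: (L1_bmul (M := 2 * expR (`|complex.Im lam| * M))) => //.
  exact: cmeasurable_wave.
move=> t /=; rewrite in_itv/= => /andP[at_ tx].
rewrite (le_trans (cn1_wave _ _))// ler_wpM2l// ler_expR ler_wpM2l//.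
rewrite /M normrM ler_wpM2l// ler_norml; apply/andP; split.
  rewrite (le_trans _ at_)// lerNl.
  by rewrite (le_trans (ler_norm _))// normrN lerDl.
by rewrite (le_trans tx)// (le_trans (ler_norm _))// lerDr.
Qed.

Lemma L1_wavemulr (lam : C) (a x c : R) (f : R -> C) :
  L1_on `[a, x] f -> L1_on `[a, x] (fun s => f s * wave lam (c * s)).
Proof. by move=> /(L1_wavemul lam c); apply: L1_eq => // s _; rewrite mulrC. Qed.

(** Multiplying the [j]-th equation by the integrating factor
    [wave lam (- b j * s)] removes the term in [lam]. *)
Lemma duhamel (Q : R -> 'M[C]_2) (lam : C) (y : R -> 'cV[C]_2) (j : 'I_2) x :
  potential Q -> dirac_solution b1 b2 Q lam y -> x \in `[0, 1] ->
  y x j ord0 = wave lam (b j * x) * (y 0 j ord0 + cint `[0, x] (fun s =>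
    - 'i%C * (b j)%:C%C * (wave lam (- b j * s) *
       (Q s j (rev_ord j) * y s (rev_ord j) ord0)))).
Proof.
move=> pQ ys x1; have [x0 xle1] : 0 <= x /\ x <= 1 by move: x1; rewrite in_itv => /andP.
have L := L1_potential j (rev_ord j) pQ ys.
have [_ [M yM]] := dirac_bounded j ys; have [my _] := dirac_bounded j ys.
move: ys => [dy [/(_ j)[di yE] ae]].
have sub : `[0, x] `<=` (`[0, 1] : set R).
  by move=> t /=; rewrite !in_itv/= => /andP[->/=/le_trans]; exact.
have di' : L1_on `[0, x] (fun t => dy t j ord0) by apply: L1_itvS di.
pose F t := wave lam (- b j * t).
pose f t := 'i%C * lam * (- b j)%:C%C * wave lam (- b j * t).
have fi : L1_on `[0, x] f by apply: L1Zl => //; exact: L1_wave.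
have FE t : t \in `[0, x] -> F t = F 0 + cint `[0, t] f.
  by rewrite in_itv/= => /andP[t0 _]; exact: wave_ftc.
have GE t : t \in `[0, x] -> y t j ord0 = y 0 j ord0 + cint `[0, t] (fun t => dy t j ord0).
  by move=> tx; apply: yE; apply: sub.
have := cint_product x0 fi di' FE GE.
rewrite {2}/F mulr0 wave0 mul1r => E.
rewrite -[LHS]mul1r -(waveNK lam (b j * x)) -mulrA -mulNr E; congr (_ * (_ + _)).
have Lx : L1_on `[0, x] (fun s => Q s j (rev_ord j) * y s (rev_ord j) ord0).
  by apply: L1_itvS L.
apply: cint_ae => //.
- apply: L1D => //; last exact: L1_wavemul.
  rewrite /f; apply: (L1_eq (f := fun t => y t j ord0 * ('i%C * lam * (- b j)%:C%C * wave lam (- b j * t)))) => //.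
    by move=> t _; rewrite mulrC.
  apply: (L1_bmul (M := M)) => //; last by move=> t /sub/yM.
  by case: my => m1 m2; split; [apply: measurable_funS m1|apply: measurable_funS m2].
- by apply: L1Zl => //; exact: L1_wavemul.
- case: ae => N [mN N0 h]; exists N; split => //; apply: subset_trans h => t /=.
  apply: contra_not => h tx; have t1 := sub _ tx.
  rewrite (dirac_derivative (pQ.1 t j t1) (h t1)) /f /F rmorphN/=; ring.
Qed.

End duhamel.

(** * Finite speed of propagation *)

Section propagation.
Context {R : realType}.
Local Notation mu := (@lebesgue_measure R).
Local Notation C := R[i].
Variables (b1 b2 : R).
Hypotheses (hb1 : b1 < 0) (hb2 : 0 < b2).
Local Notation b := (bcoef b1 b2).

Lemma bcoef_bounds j : b1 <= b j <= b2.
Proof. by rewrite /bcoef; case: ifP => _; rewrite lexx ltW// (lt_trans hb1). Qed.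

Lemma bcoef_normr j : `|b j| <= b2 - b1.
Proof.
have /andP[b1j bj2] := bcoef_bounds j.
rewrite ler_norml opprB lerBlDr (le_trans b1j) ?lerDl ?(ltW hb2)//=.
by rewrite (le_trans bj2)// lerDl oppr_ge0 ltW.
Qed.

Lemma cn1_bcoef j : cn1 (- 'i%C * (b j)%:C%C) = `|b j|.
Proof.
by rewrite /cn1 cReM cImM/= oppr0 !mul0r !mulr0 subrr normr0 !add0r mulN1r normrN.
Qed.

Variables (X : R) (q : 'I_2 -> R -> C).
Hypothesis q_L1 : forall j, L1_on `[0, X] (q j).

Definition coupling s : R := (b2 - b1) * \sum_(j < 2) cn1 (q j s).

Lemma coupling_ge0 s : 0 <= coupling s.
Proof.
rewrite mulr_ge0//; first by rewrite subr_ge0 ltW// (lt_trans hb1).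
by apply: sumr_ge0 => j _; exact: cn1_ge0.
Qed.

Lemma coupling_L1 : L1R `[0, X] coupling.
Proof.
apply: L1RZl => //; rewrite (_ : (fun _ => _) =
  fun s => cn1 (q ord0 s) + cn1 (q (rev_ord ord0) s)).
  by apply: L1RD => //; exact: L1_cn1.
by apply/funext => s; rewrite (sum_ord2 ord0).
Qed.

(** One solution [u m] for each spectral parameter [lam m]. The term [h m]
    outside of the coupling integral is the initial value for a solution of the
    Dirac system, and a forcing term for a difference of two solutions. *)
Variables (N : nat) (a lam : 'I_N -> C).
Variables (u h : 'I_N -> 'I_2 -> R -> C).
Hypothesis u_meas : forall m j, cmeasurable `[0, X] (u m j).
Hypothesis u_bounded : forall m j, exists M, forall s, s \in `[0, X] -> cn1 (u m j s) <= M.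
Hypothesis uE : forall m j x, x \in `[0, X] ->
  u m j x = wave (lam m) (b j * x) * (h m j x + cint `[0, x] (fun s =>
    - 'i%C * (b j)%:C%C * (wave (lam m) (- b j * s) * (q j s * u m (rev_ord j) s)))).

(** The superposition of the solutions with weights [a m], with the second
    argument [theta] of the waves playing the part of a space variable. *)
Definition superpose (v : 'I_N -> R -> C) theta x : C :=
  \sum_(m < N) a m * (wave (lam m) theta * v m x).

Let L1_term m j : L1_on `[0, X] (fun s => q j s * u m (rev_ord j) s).
Proof.
by have [M uM] := u_bounded m (rev_ord j); exact: (L1_bmulr (M := M)).
Qed.

(** In the variables [(theta, x)] the superposition solves the hyperbolic system
    whose [j]-th component travels along the lines
    [theta + b j * x = constant]; the spectral parameters have disappeared from
    the equation. *)
Lemma superpose_transport j x theta : x \in `[0, X] ->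
  superpose (fun m => u m j) theta x =
  superpose (fun m => h m j) (theta + b j * x) x +
  cint `[0, x] (fun s => - 'i%C * (b j)%:C%C * (q j s *
     superpose (fun m => u m (rev_ord j)) (theta + b j * (x - s)) s)) /\
  L1_on `[0, x] (fun s => - 'i%C * (b j)%:C%C * (q j s *
     superpose (fun m => u m (rev_ord j)) (theta + b j * (x - s)) s)).
Proof.
move=> xX; have [x0 xleX] : 0 <= x /\ x <= X by move: xX; rewrite in_itv => /andP.
have Lm m : L1_on `[0, x] (fun s => - 'i%C * (b j)%:C%C * (wave (lam m) (- b j * s) *
    (q j s * u m (rev_ord j) s))).
  by apply: L1Zl => //; apply: L1_wavemul; apply: L1_itvS (L1_term m j).
pose c m := a m * wave (lam m) (theta + b j * x).
have E : {in `[0, x]%classic, (fun s => \sum_(m < N) c m * (- 'i%C * (b j)%:C%C *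
    (wave (lam m) (- b j * s) * (q j s * u m (rev_ord j) s)))) =1
   (fun s => - 'i%C * (b j)%:C%C * (q j s *
     superpose (fun m => u m (rev_ord j)) (theta + b j * (x - s)) s))}.
  move=> s _; rewrite /superpose !mulr_sumr; apply: eq_bigr => m _.
  rewrite (_ : theta + b j * (x - s) = (theta + b j * x) + - b j * s); last by ring.
  by rewrite [in RHS]waveD /c; ring.
split; last by apply: (L1_eq _ E) => //; apply: L1_sum => // m; exact: L1Zl.
rewrite -(eq_cint E) cint_sum//; last by move=> m; exact: L1Zl.
rewrite /superpose -big_split/=; apply: eq_bigr => m _.
by rewrite cintZl// (uE _ _ xX) /c waveD; ring.
Qed.

(** Finite speed of propagation: the value at [(theta, x)] depends on the data on
    [[theta + b1 * x, theta + b2 * x]] only. As the coefficients of the transport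
    system involve neither the weights nor the spectral parameters, the constant
    given by Gronwall's inequality depends on the potential alone, however large
    the individual terms of the superposition are. *)
Lemma propagation (lo hi A rho : R) :
  0 <= A -> \int[mu]_(s in `[0, X]) coupling s <= rho ->
  (forall j x theta, x \in `[0, X] -> lo <= theta + b1 * x -> theta + b2 * x <= hi ->
    cn1 (superpose (fun m => h m j) (theta + b j * x) x) <= A) ->
  forall j x theta, x \in `[0, X] -> lo <= theta + b1 * x -> theta + b2 * x <= hi ->
    cn1 (superpose (fun m => u m j) theta x) <= A * expR rho.
Proof.
move=> A0 Qrho HA j0 x0 theta0 x0X lo0 hi0.
pose V s c := exists j theta, [/\ lo <= theta + b1 * s, theta + b2 * s <= hi &
  c = cn1 (superpose (fun m => u m j) theta s)].
have [Mf MfP] := choice (fun p : 'I_N * 'I_2 => u_bounded p.1 p.2).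
(* A crude bound, which may depend on the weights and the spectral parameters:
   Gronwall's inequality only needs some bound to start from. *)
pose M0 := \sum_(m < N) \sum_(j < 2)
  cn1 (a m) * (2 * expR (`|complex.Im (lam m)| * (`|lo| + `|hi|)) * `|Mf (m, j)|).
apply: (@gronwall R coupling X coupling_ge0 coupling_L1 V M0 A rho _ _ A0 Qrho x0 _ x0X); last first.
- by exists j0, theta0.
- move=> M iM VM x c xX [j [theta [lox hix ->]]].
  have [x_ge0 xleX] : 0 <= x /\ x <= X by move: xX; rewrite in_itv => /andP.
  have [-> Li] := superpose_transport j theta xX.
  rewrite (le_trans (cn1D _ _))// lerD//; first exact: HA.
  rewrite (le_trans (cn1_cint _ Li))//; apply: le_Rintegral => //.
  + exact: L1_cn1.
  + by apply: L1RS iM => // t /=; rewrite !in_itv/= => /andP[->/=/le_trans]; exact.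
  + move=> s /=; rewrite in_itv/= => /andP[s0 sx].
    have sX : s \in `[0, X] by rewrite in_itv/= s0 (le_trans sx).
    rewrite (le_trans (cn1M _ _))// cn1_bcoef.
    have /andP[b1j bj2] := bcoef_bounds j; have bj := bcoef_normr j.
    have VMs : cn1 (superpose (fun m => u m (rev_ord j)) (theta + b j * (x - s)) s) <= M s.
      apply: (VM s _ sX); exists (rev_ord j), (theta + b j * (x - s)); split => //.
        apply: (le_trans lox); have : b1 * (x - s) <= b j * (x - s).
          by rewrite ler_wpM2r// subr_ge0.
        by lra.
      apply: le_trans hix; have : b j * (x - s) <= b2 * (x - s).
        by rewrite ler_wpM2r// subr_ge0.
      by lra.
    rewrite /coupling -mulrA ler_pM ?cn1_ge0//.
    rewrite (le_trans (cn1M _ _))// ler_pM ?cn1_ge0//.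
    by rewrite (sum_ord2 j) lerDl cn1_ge0.
- move=> s c sX [j [theta [los his ->]]].
  have [s0 sleX] : 0 <= s /\ s <= X by move: sX; rewrite in_itv => /andP.
  have bs1 : b1 * s <= 0 by rewrite nmulr_rle0.
  have bs2 : 0 <= b2 * s by rewrite pmulr_rge0.
  have th : `|theta| <= `|lo| + `|hi|.
    have lo' := ler_norm (- lo); have hi' := ler_norm hi.
    have lo1 := normr_ge0 lo; have hi1 := normr_ge0 hi; rewrite normrN in lo'.
    by rewrite ler_norml; apply/andP; split; lra.
  rewrite (le_trans (cn1_sum _ _ _))// ler_sum// => m _.
  apply: (@le_trans _ _ (cn1 (a m) * (2 * expR (`|complex.Im (lam m)| * (`|lo| + `|hi|)) * `|Mf (m, j)|))).
    rewrite (le_trans (cn1M _ _))// ler_wpM2l ?cn1_ge0//.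
    rewrite (le_trans (cn1M _ _))// ler_pM ?cn1_ge0//.
      by rewrite (le_trans (cn1_wave _ _))// ler_wpM2l// ler_expR ler_wpM2l.
    by rewrite (le_trans (MfP (m, j) s sX))// ler_norm.
  by rewrite (sum_ord2 j) lerDl !mulr_ge0 ?cn1_ge0 ?expR_ge0.
Qed.

End propagation.

(** * Stability of superposed solutions *)

Section stability.
Context {R : realType}.
Local Notation mu := (@lebesgue_measure R).
Local Notation C := R[i].
Variables (b1 b2 : R).
Hypotheses (hb1 : b1 < 0) (hb2 : 0 < b2).
Local Notation b := (bcoef b1 b2).
Local Notation kap j := (b (rev_ord j) - b j).

Let b21 : 0 <= b2 - b1.
Proof. by rewrite subr_ge0 ltW// (lt_trans hb1). Qed.

Lemma kap_normr j : `|kap j| <= b2 - b1.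
Proof.
have /andP[b1j bj2] := bcoef_bounds hb1 hb2 j.
have /andP[b1k bk2] := bcoef_bounds hb1 hb2 (rev_ord j).
by rewrite ler_norml; apply/andP; split; lra.
Qed.

(** The data of the superposition are the wave [wave lam0] weighted by [W], which
    is monotone with values in [[0, 1]] on the interval that influences the final
    point [(0, X)]. *)
Variables (X : R) (lam0 : C) (W W' : R -> R).
Hypothesis X0 : 0 <= X.
Hypothesis dW : forall t, is_derive t (1 : R) W (W' t).
Hypothesis cW' : continuous W'.
Hypothesis W01 : forall t, t \in `[b1 * X, b2 * X] -> 0 <= W t <= 1.
Hypothesis W'm : (forall t, t \in `[b1 * X, b2 * X] -> 0 <= W' t) \/
                 (forall t, t \in `[b1 * X, b2 * X] -> W' t <= 0).

(** [p] is the difference of the potentials, and [S] bounds its oscillatory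
    integrals at the frequencies of the statement. *)
Variables (p : 'I_2 -> R -> C) (S : R).
Hypothesis p_L1 : forall j, L1_on `[0, X] (p j).
Hypothesis pS : forall j s t, 0 <= s -> s <= t -> t <= X ->
  cn1 (cint `[s, t] (fun r => p j r * wave lam0 (kap j * r))) <= S.

Let S0 : 0 <= S.
Proof. by apply: le_trans (pS ord0 (lexx 0) (lexx 0) X0); exact: cn1_ge0. Qed.

Definition growth : R := 4 * expR (2 * (b2 - b1) * `|complex.Im lam0| * X).

(** The weighted oscillatory integrals are controlled by the unweighted ones
    through the second mean value theorem. The phase at [eta] costs the factor
    [growth]: the hypothesis on the argument of [W] places [eta] within
    [2 * (b2 - b1) * X] of the origin. *)
Lemma oscillation_bound j sig x eta : 0 <= sig -> sig <= x -> x <= X ->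
  (forall s, s \in `[sig, x] -> eta + kap j * s \in `[b1 * X, b2 * X]) ->
  cn1 (cint `[sig, x] (fun s => p j s *
    (wave lam0 (eta + kap j * s) * (W (eta + kap j * s))%:C%C))) <= growth * S.
Proof.
move=> sig0 sigx xX dom; set k := kap j.
have x0 : 0 <= x by apply: le_trans sigx.
have p_L1' : L1_on `[sig, x] (p j) by apply: L1_itvS (p_L1 j).
pose f s := p j s * wave lam0 (k * s).
have fi : L1_on `[sig, x] f.
  by apply: (L1_eq _ _ (L1_wavemul lam0 k p_L1')) => // s _; rewrite mulrC.
pose w s := W (eta + k * s); pose w' s := W' (eta + k * s) * k.
have dlin (t : R) : is_derive t (1:R) (fun s => eta + k * s) k.
  by apply: is_derive_eq; rewrite add0r mul1r /GRing.scale/= mulr1.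
have dw t : is_derive t (1:R) w (w' t) by exact: (is_derive1_comp (dW _) (dlin t)).
have clin : continuous (fun s => eta + k * s).
  by move=> t; apply: differentiable_continuous; apply/derivable1_diffP; have [] := dlin t.
have cw' : continuous w'.
  move=> t; apply: cvgMl; apply: (continuous_comp (clin t)); exact: cW'.
have w01 t : t \in `[sig, x] -> 0 <= w t <= 1 by move=> /dom; exact: W01.
have w'm : (forall t, t \in `[sig, x] -> 0 <= w' t) \/
    (forall t, t \in `[sig, x] -> w' t <= 0).
  have [k0|/ltW k0] := leP 0 k; case: W'm => hm.
  - by left => t /dom/hm h; rewrite mulr_ge0.
  - by right => t /dom/hm h; rewrite mulr_le0_ge0.
  - by right => t /dom/hm h; rewrite mulr_ge0_le0.
  - by left => t /dom/hm h; rewrite mulr_le0.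
have E : {in `[sig, x]%classic, (fun s => wave lam0 eta * (f s * (w s)%:C%C)) =1
  (fun s => p j s * (wave lam0 (eta + k * s) * (W (eta + k * s))%:C%C))}.
  by move=> s _; rewrite waveD /f /w; ring.
have wi : L1_on `[sig, x] (fun s => f s * (w s)%:C%C).
  apply: (L1_bmulr (M := 1)) => //.
    split; last exact: measurable_cst.
    apply: measurable_funTS; apply: continuous_measurable_fun => t.
    by apply: differentiable_continuous; apply/derivable1_diffP; have [] := dw t.
  move=> t tx; rewrite /cn1/= normr0 addr0.
  by have /andP[w0 w1] := w01 t tx; rewrite ger0_norm.
rewrite -(eq_cint E) cintZl// (le_trans (cn1M _ _))//.
have fS : cn1 (cint `[sig, x] (fun s => f s * (w s)%:C%C)) <= 2 * S.
  apply: (cn1_cint_monotone sigx fi dw cw' w01 w'm) => t.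
  rewrite in_itv/= => /andP[sigt tx].
  by apply: pS => //; apply: le_trans sigt.
rewrite /growth (_ : 4 = 2 * 2); last by ring.
rewrite -[2 * 2 * _]mulrA [2 * expR _]mulrC mulrA -[leRHS]mulrA.
rewrite ler_pM ?cn1_ge0//.
rewrite (le_trans (cn1_wave _ _))// ler_wpM2l// ler_expR.
rewrite -[2 * _ * _ * _]mulrA [X in _ <= _ * X]mulrC mulrA [X in _ <= X]mulrC ler_wpM2l//.
have sx : sig \in `[sig, x] by rewrite in_itv/= lexx.
have := dom _ sx; rewrite in_itv/= -/k => /andP[d1 d2].
have kX : `|k * sig| <= (b2 - b1) * X.
  rewrite normrM ler_pM ?normr_ge0//; first exact: kap_normr.
  by rewrite ger0_norm// (le_trans sigx).
move: kX; rewrite ler_norml => /andP[k1 k2].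
have b1X : b1 * X <= 0 by rewrite nmulr_rle0.
have b2X : 0 <= b2 * X by rewrite pmulr_rge0.
have e0 : 2 * (b2 - b1) * X = 2 * (b2 * X) - 2 * (b1 * X) by ring.
have e1 : (b2 - b1) * X = b2 * X - b1 * X by ring.
rewrite e1 in k1 k2; rewrite e0 ler_norml; apply/andP; split; lra.
Qed.

Variables (N : nat) (a lam : 'I_N -> C).
Hypothesis aW : forall t, \sum_(m < N) a m * wave (lam m) t = wave lam0 t * (W t)%:C%C.

(** Depends on [m] but not on [theta]: multiplying the weights [a m] by these
    numbers gives a superposition of the same kind. *)
Let tail_coef j x m sig := cint `[sig, x] (fun s => p j s * wave (lam m) (kap j * s)).

(** The weights [a m * tail_coef j x m sig] make the data of the superposition a
    weighted oscillatory integral of [p]. *)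
Lemma tail_coef_bound j sig x eta : 0 <= sig -> sig <= x -> x <= X ->
  (forall s, s \in `[sig, x] -> eta + kap j * s \in `[b1 * X, b2 * X]) ->
  cn1 (\sum_(m < N) a m * wave (lam m) eta * tail_coef j x m sig) <= growth * S.
Proof.
move=> sig0 sigx xX dom; apply: le_trans (oscillation_bound sig0 sigx xX dom).
have p_L1' : L1_on `[sig, x] (p j) by apply: L1_itvS (p_L1 j).
have Lm m : L1_on `[sig, x] (fun s => p j s * wave (lam m) (kap j * s)).
  exact: L1_wavemulr.
rewrite (@eq_cint _ _ _ (fun s => \sum_(m < N) (a m * wave (lam m) eta) *
  (p j s * wave (lam m) (kap j * s)))); last first.
  move=> s _; rewrite -aW mulr_sumr; apply: eq_bigr => m _.
  by rewrite waveD; ring.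
rewrite cint_sum//; last by move=> m; exact: L1Zl.
by rewrite (eq_bigr _ (fun m _ => cintZl _ _ (Lm m)))// => m _; exact: measurable_itv.
Qed.

Variables (q : 'I_2 -> R -> C) (c : 'I_2 -> C) (rho : R).
Hypothesis q_L1 : forall j, L1_on `[0, X] (q j).
Hypothesis qrho : \int[mu]_(s in `[0, X]) coupling b1 b2 q s <= rho.
Hypothesis c1 : forall j, cn1 (c j) <= 1.
Variable y : 'I_N -> 'I_2 -> R -> C.
Hypothesis y_meas : forall m j, cmeasurable `[0, X] (y m j).
Hypothesis y_bounded : forall m j, exists M, forall s, s \in `[0, X] -> cn1 (y m j s) <= M.
Hypothesis yE : forall m j x, x \in `[0, X] ->
  y m j x = wave (lam m) (b j * x) * (c j + cint `[0, x] (fun s =>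
    - 'i%C * (b j)%:C%C * (wave (lam m) (- b j * s) * (q j s * y m (rev_ord j) s)))).

(** The term that appears in the equation for the difference of two solutions
    when the coupling integral is written with the second potential. *)
Let forcing m j x := cint `[0, x] (fun s =>
  - 'i%C * (b j)%:C%C * (wave (lam m) (- b j * s) * (p j s * y m (rev_ord j) s))).

Lemma L1_bounded_term m j k (r : 'I_2 -> R -> C) : L1_on `[0, X] (r j) ->
  L1_on `[0, X] (fun s => r j s * y m k s).
Proof. by move=> ri; have [M yM] := y_bounded m k; exact: (L1_bmulr (M := M)). Qed.

Let g m k s : C := - 'i%C * (b k)%:C%C * (wave (lam m) (- b k * s) * (q k s * y m (rev_ord k) s)).

Let gi m k : L1_on `[0, X] (g m k).
Proof. by apply: L1Zl => //; apply: L1_wavemul; exact: L1_bounded_term. Qed.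

(** Duhamel's formula for the solution inside of the integral, followed by an
    exchange of the order of integration, moves the integration of [p] inside. *)
Lemma forcing_split m j x : x \in `[0, X] ->
  forcing m j x = - 'i%C * (b j)%:C%C * (c (rev_ord j) * tail_coef j x m 0 +
    cint `[0, x] (fun sig => g m (rev_ord j) sig * tail_coef j x m sig)).
Proof.
rewrite in_itv/= => /andP[x0 xX].
pose f s := p j s * wave (lam m) (kap j * s).
have fi : L1_on `[0, x] f.
  by apply: L1_wavemulr; apply: L1_itvS (p_L1 j).
have gi' : L1_on `[0, x] (g m (rev_ord j)) by apply: L1_itvS (gi m (rev_ord j)).
rewrite -(cint_swap fi gi') -(cintZl (c (rev_ord j)) (measurable_itv _) fi).
rewrite -cintD//; [|exact: L1Zl|exact: L1_lower].
rewrite -cintZl//; last by apply: L1D => //; [exact: L1Zl|exact: L1_lower].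
apply: eq_cint => s /set_mem/=; rewrite in_itv/= => /andP[s0 sx].
have sX : s \in `[0, X] by rewrite in_itv/= s0 (le_trans sx).
rewrite (yE m (rev_ord j) sX) /f (_ : kap j * s = b (rev_ord j) * s + - b j * s); last by ring.
by rewrite waveD /g; ring.
Qed.

(** By [forcing_split], the superposed forcing term is made of superpositions with
    weights [a m * tail_coef j x m sig]. Their data are small by
    [tail_coef_bound], hence so are their values by [propagation]. *)
Lemma forcing_bound j x theta : x \in `[0, X] ->
  b1 * X <= theta + b1 * x -> theta + b2 * x <= b2 * X ->
  cn1 (superpose a lam (fun m => forcing m j) (theta + b j * x) x) <=
  (b2 - b1) * (1 + rho * expR rho) * (growth * S).
Proof.
move=> xX lox hix; have [x0 xleX] : 0 <= x /\ x <= X by move: xX; rewrite in_itv => /andP.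
set k := rev_ord j; pose th := theta + b j * x.
have GS0 : 0 <= growth * S by rewrite mulr_ge0// /growth mulr_ge0// expR_ge0.
have mx := measurable_itv `[0, x].
have fi m : L1_on `[0, x] (fun s => p j s * wave (lam m) (kap j * s)).
  by apply: L1_wavemulr; apply: L1_itvS (p_L1 j).
have gi' m : L1_on `[0, x] (g m k) by apply: L1_itvS (gi m k).
pose Z sig := superpose (fun m => a m * tail_coef j x m sig) lam (fun m => y m j)
   (th - b k * sig) sig.
have ZE : {in `[0, x]%classic, (fun sig => \sum_(m < N) a m * wave (lam m) th *
    (g m k sig * tail_coef j x m sig)) =1
    (fun sig => - 'i%C * (b k)%:C%C * (q k sig * Z sig))}.
  move=> s _; rewrite /Z /superpose !mulr_sumr; apply: eq_bigr => m _.
  rewrite /g rev_ordK -/th (_ : th - b k * s = th + - b k * s); last by ring.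
  by rewrite [in RHS]waveD; ring.
have Zi : L1_on `[0, x] (fun sig => - 'i%C * (b k)%:C%C * (q k sig * Z sig)).
  apply: (L1_eq _ ZE) => //; apply: L1_sum => // m; apply: L1Zl => //.
  exact: L1_upper.
have -> : superpose a lam (fun m => forcing m j) th x = - 'i%C * (b j)%:C%C *
   (c k * (\sum_(m < N) a m * wave (lam m) th * tail_coef j x m 0) +
    cint `[0, x] (fun sig => - 'i%C * (b k)%:C%C * (q k sig * Z sig))).
  rewrite -(eq_cint ZE) cint_sum//; last by move=> m; apply: L1Zl => //; exact: L1_upper.
  rewrite mulr_sumr -big_split mulr_sumr; apply: eq_bigr => m _ /=.
  rewrite cintZl//; last exact: L1_upper.
  by rewrite forcing_split//; ring.
rewrite (le_trans (cn1M _ _))// cn1_bcoef -mulrA ler_pM ?cn1_ge0 ?bcoef_normr//.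
(* A path from the initial line to [(theta, x)] that spends [x - s] in the state
   [j], [s - sig] in the state [k] and [sig] at any admissible speed starts in
   the interval seen from [(0, X)]. *)
have dom0 sig s eta : 0 <= sig -> sig <= s -> s <= x ->
    th - b k * sig + b1 * sig <= eta -> eta <= th - b k * sig + b2 * sig ->
    eta + kap j * s \in `[b1 * X, b2 * X].
  move=> sig0 sigs sx e1 e2.
  have /andP[b1j bj2] := bcoef_bounds hb1 hb2 j.
  have /andP[b1k bk2] := bcoef_bounds hb1 hb2 k.
  have h1 : b1 * (x - s) <= b j * (x - s) by rewrite ler_wpM2r// subr_ge0.
  have h2 : b j * (x - s) <= b2 * (x - s) by rewrite ler_wpM2r// subr_ge0.
  have h3 : b1 * (s - sig) <= b k * (s - sig) by rewrite ler_wpM2r// subr_ge0.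
  have h4 : b k * (s - sig) <= b2 * (s - sig) by rewrite ler_wpM2r// subr_ge0.
  rewrite /th in e1 e2; rewrite in_itv/= -/k; apply/andP.
  by split; move: lox hix h1 h2 h3 h4 e1 e2; rewrite !mulrBr !mulrBl; lra.
have Zb sig : sig \in `[0, x] -> cn1 (Z sig) <= growth * S * expR rho.
  move=> sigx; have [sig0 slex] : 0 <= sig /\ sig <= x by move: sigx; rewrite in_itv => /andP.
  have sigX : sig \in `[0, X] by rewrite in_itv/= sig0 (le_trans slex).
  pose lo := th - b k * sig + b1 * sig; pose hi := th - b k * sig + b2 * sig.
  apply: (@propagation R b1 b2 hb1 hb2 X q q_L1 N
    (fun m => a m * tail_coef j x m sig) lam y (fun _ i _ => c i)
    y_meas y_bounded yE lo hi (growth * S) rho) => // i t eta tX lot hit.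
  have t0 : 0 <= t by move: tX; rewrite in_itv => /andP[].
  have /andP[b1i bi2] := bcoef_bounds hb1 hb2 i.
  have -> : superpose (fun m => a m * tail_coef j x m sig) lam (fun=> (fun=> c i))
      (eta + b i * t) t =
    c i * \sum_(m < N) a m * wave (lam m) (eta + b i * t) * tail_coef j x m sig.
    by rewrite /superpose mulr_sumr; apply: eq_bigr => m _; ring.
  rewrite (le_trans (cn1M _ _))// -[leRHS]mul1r ler_pM ?cn1_ge0//.
  apply: tail_coef_bound => // s; rewrite in_itv/= => /andP[sigs sx].
  have h1 : b1 * t <= b i * t by rewrite ler_wpM2r.
  have h2 : b i * t <= b2 * t by rewrite ler_wpM2r.
  by apply: (dom0 sig s) => //; rewrite -/lo -/hi; lra.
rewrite mulrDl mul1r (le_trans (cn1D _ _))// lerD//.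
  rewrite (le_trans (cn1M _ _))// -[leRHS]mul1r ler_pM ?cn1_ge0//.
  apply: tail_coef_bound => // s; rewrite in_itv/= => /andP[s0 sx].
  by apply: (dom0 0 s) => //; lra.
rewrite (le_trans (cn1_cint mx Zi))//.
have coup0 t : 0 <= coupling b1 b2 q t by exact: coupling_ge0.
have icoup := coupling_L1 b1 b2 q_L1.
have icx : L1R `[0, x] (coupling b1 b2 q).
  by apply: L1RS icoup => // t /=; rewrite !in_itv/= => /andP[->/=/le_trans]; exact.
apply: (@le_trans _ _ (\int[mu]_(t in `[0, x]) (growth * S * expR rho * coupling b1 b2 q t))).
  apply: le_Rintegral => //; [exact: L1_cn1|exact: L1RZl|].
  move=> s /= sx; rewrite (le_trans (cn1M _ _))// cn1_bcoef.
  rewrite [leRHS]mulrC /coupling -[leRHS]mulrA ler_pM ?cn1_ge0 ?bcoef_normr//.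
  rewrite (le_trans (cn1M _ _))// ler_pM ?cn1_ge0 ?Zb//.
  by rewrite (sum_ord2 k) lerDl cn1_ge0.
rewrite RintegralZl// [leRHS](_ : _ = growth * S * expR rho * rho); last by ring.
rewrite ler_wpM2l//.
  by rewrite mulr_ge0 ?expR_ge0.
apply: le_trans qrho; rewrite -subr_ge0 Rintegral_itvB ?bnd_simp//.
by apply: Rintegral_ge0 => t _.
Qed.

Variables (qt : 'I_2 -> R -> C) (yt : 'I_N -> 'I_2 -> R -> C).
Hypothesis qt_L1 : forall j, L1_on `[0, X] (qt j).
Hypothesis qtrho : \int[mu]_(s in `[0, X]) coupling b1 b2 qt s <= rho.
Hypothesis yt_meas : forall m j, cmeasurable `[0, X] (yt m j).
Hypothesis yt_bounded : forall m j, exists M, forall s, s \in `[0, X] -> cn1 (yt m j s) <= M.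
Hypothesis ytE : forall m j x, x \in `[0, X] ->
  yt m j x = wave (lam m) (b j * x) * (c j + cint `[0, x] (fun s =>
    - 'i%C * (b j)%:C%C * (wave (lam m) (- b j * s) * (qt j s * yt m (rev_ord j) s)))).
Hypothesis pE : forall j s, p j s = q j s - qt j s.

(** The difference [q * y - qt * yt = p * y + qt * (y - yt)] makes the difference
    of the solutions a solution for the potential [qt] with the forcing term of
    [forcing_bound], and a second use of [propagation] concludes. *)
Lemma stability j :
  cn1 (\sum_(m < N) a m * (y m j X - yt m j X)) <=
  (b2 - b1) * (1 + rho * expR rho) * (growth * S) * expR rho.
Proof.
pose d m i s := y m i s - yt m i s.
have XX : X \in `[0, X] by rewrite in_itv/= X0 lexx.
have rho0 : 0 <= rho.
  by apply: le_trans qrho; apply: Rintegral_ge0 => t _; exact: coupling_ge0.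
have md m i : cmeasurable `[0, X] (d m i).
  apply: (cmeasurable_eq (f := fun s => y m i s + (-1) * yt m i s)).
    by move=> s _; rewrite mulN1r.
  by apply: cmeasurableD => //; apply: cmeasurableM => //; exact: cmeasurable_cst.
have bd m i : exists M, forall s, s \in `[0, X] -> cn1 (d m i s) <= M.
  have [M1 h1] := y_bounded m i; have [M2 h2] := yt_bounded m i; exists (M1 + M2) => s sX.
  by rewrite (le_trans (cn1D _ _))// cn1N lerD ?h1 ?h2.
have Ly m i k (r : 'I_2 -> R -> C) : L1_on `[0, X] (r k) ->
    L1_on `[0, X] (fun s => r k s * d m i s).
  by move=> ri; have [M dM] := bd m i; exact: (L1_bmulr (M := M)).
have dE m i x : x \in `[0, X] -> d m i x = wave (lam m) (b i * x) *
    (forcing m i x + cint `[0, x] (fun s => - 'i%C * (b i)%:C%C *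
      (wave (lam m) (- b i * s) * (qt i s * d m (rev_ord i) s)))).
  move=> xX; have xleX : x <= X by move: xX; rewrite in_itv => /andP[].
  have yi : L1_on `[0, x] (g m i) by apply: L1_itvS (gi m i).
  have yti : L1_on `[0, x] (fun s => - 'i%C * (b i)%:C%C *
      (wave (lam m) (- b i * s) * (qt i s * yt m (rev_ord i) s))).
    apply: L1Zl => //; apply: L1_wavemul; apply: (@L1_itvS _ 0 X) => //.
    by have [M yM] := yt_bounded m (rev_ord i); exact: (L1_bmulr (M := M)).
  rewrite /d (yE m i xX) (ytE m i xX) -mulrBr; congr (_ * _).
  rewrite opprD addrACA subrr add0r -cintB// /forcing -cintD//; last 2 first.
  - apply: L1Zl => //; apply: L1_wavemul; apply: (@L1_itvS _ 0 X) => //.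
    exact: L1_bounded_term.
  - apply: L1Zl => //; apply: L1_wavemul; apply: (@L1_itvS _ 0 X) => //.
    exact: Ly.
  by apply: eq_cint => s _; rewrite pE /d; ring.
have GS0 : 0 <= growth * S by rewrite mulr_ge0// /growth mulr_ge0// expR_ge0.
have A0 : 0 <= (b2 - b1) * (1 + rho * expR rho) * (growth * S).
  by rewrite !mulr_ge0// addr_ge0// mulr_ge0// expR_ge0.
have := @propagation R b1 b2 hb1 hb2 X qt qt_L1 N a lam d forcing md bd dE
  (b1 * X) (b2 * X) _ rho A0 qtrho forcing_bound j X 0 XX.
rewrite !add0r => /(_ (lexx _) (lexx _)); rewrite /superpose.
by under eq_bigr do rewrite wave0 mul1r.
Qed.

End stability.

(** * Separation of the two columns by a polynomial filter *)

Section step.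
Context {R : realType}.
Local Notation mu := (@lebesgue_measure R).
Local Notation C := R[i].

(** Polynomials tending to the indicator of [v < 1] on [[0, 2]] away from 1, with
    values in [[0, 1]]: the threshold is where [2 ^ n * (v / 2) ^ n] changes from
    vanishing to exploding. *)
Definition step_poly n : {poly R} := (1 - (2^-1 *: 'X) ^+ n) ^+ (2 ^ n)%N.

Lemma step_polyE n v : (step_poly n).[v] = (1 - (v / 2) ^+ n) ^+ (2 ^ n)%N.
Proof. rewrite /step_poly !hornerE/=. by rewrite mulrC. Qed.

Lemma bernoulli (x : R) n : -1 <= x -> 1 + n%:R * x <= (1 + x) ^+ n.
Proof.
move=> x1; elim: n => [|n IH]; first by rewrite mul0r addr0 expr0.
have x0 : 0 <= 1 + x by lra.
rewrite exprS; apply: le_trans (ler_wpM2l x0 IH).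
rewrite -natr1; have : 0 <= n%:R * x ^+ 2 by rewrite mulr_ge0// sqr_ge0.
by rewrite expr2; lra.
Qed.

Let half01 (v : R) n : 0 <= v <= 2 -> 0 <= (v / 2) ^+ n <= 1.
Proof.
move=> /andP[v0 v2]; have h0 : 0 <= v / 2 by lra.
by rewrite exprn_ge0//= exprn_ile1//; lra.
Qed.

Lemma step_poly01 n v : 0 <= v <= 2 -> 0 <= (step_poly n).[v] <= 1.
Proof.
move=> /(half01 n)/andP[h0 h1]; rewrite step_polyE.
by rewrite exprn_ge0 ?exprn_ile1//; lra.
Qed.

Let exp2E (v : R) n : (2 ^ n)%N%:R * (v / 2) ^+ n = v ^+ n.
Proof. by rewrite natrX exprMn mulrCA -exprMn divff ?expr1n ?mulr1. Qed.

Lemma step_poly_lower n v : 0 <= v <= 2 -> 1 - v ^+ n <= (step_poly n).[v].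
Proof.
move=> v02; have /andP[h0 h1] := half01 n v02; rewrite step_polyE -(exp2E v) -mulrN.
by apply: bernoulli; lra.
Qed.

Lemma step_poly_upper n v : 1 < v <= 2 -> (step_poly n).[v] <= (v^-1) ^+ n.
Proof.
move=> /andP[v1 v2]; have v0 : 0 < v by lra.
have v02 : 0 <= v <= 2 by rewrite ltW.
have /andP[h0 h1] := half01 n v02; rewrite exprVn -[leRHS]mul1r ler_pdivlMr ?exprn_gt0//.
have /andP[s0 s1] := step_poly01 n v02.
(* with [y = (v / 2) ^ n] and [N = 2 ^ n]: [(1 - y)^N * N y <= (1 - y^2)^N <= 1] *)
apply: (@le_trans _ _ ((step_poly n).[v] * (1 + (v / 2) ^+ n) ^+ (2 ^ n)%N)).
  apply: ler_wpM2l => //; rewrite -(exp2E v).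
  by apply: le_trans (bernoulli _ _); lra.
rewrite step_polyE -exprMn exprn_ile1//.
  by rewrite mulr_ge0//; lra.
rewrite (_ : _ * _ = 1 - ((v / 2) ^+ n) ^+ 2); last by ring.
by rewrite gerBl sqr_ge0.
Qed.

Lemma step_poly_cvg1 v : 0 <= v < 1 -> (step_poly n).[v] @[n --> \oo] --> (1 : R).
Proof.
move=> /andP[v0 v1]; have v02 : 0 <= v <= 2 by rewrite v0/=; lra.
apply: (@squeeze_cvgr _ _ _ _ (fun n => 1 - v ^+ n) (fun=> 1)).
- by apply: nearW => n; rewrite step_poly_lower//=; have /andP[] := step_poly01 n v02.
- rewrite -[X in _ --> X]subr0; apply: cvgB; first exact: cvg_cst.
  by apply: cvg_expr; rewrite ger0_norm.
- exact: cvg_cst.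
Qed.

Lemma step_poly_cvg0 v : 1 < v <= 2 -> (step_poly n).[v] @[n --> \oo] --> (0 : R).
Proof.
move=> v12; have /andP[v1 v2] := v12; have v0 : 0 < v by lra.
have v02 : 0 <= v <= 2 by rewrite ltW.
apply: (@squeeze_cvgr _ _ _ _ (fun=> 0) (fun n => v^-1 ^+ n)).
- by apply: nearW => n; rewrite step_poly_upper// andbT; have /andP[] := step_poly01 n v02.
- exact: cvg_cst.
- by apply: cvg_expr; rewrite ger0_norm ?invr_ge0 ?(ltW v0)// invf_lt1.
Qed.

Lemma step_poly_deriv n v : 0 <= v <= 2 -> (step_poly n)^`().[v] <= 0.
Proof.
move=> v02; have /andP[v0 v2] := v02; have /andP[h0 h1] := half01 n v02.
rewrite /step_poly deriv_exp derivB derivC sub0r deriv_exp derivZ derivX.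
rewrite hornerMn hornerM hornerN hornerMn !hornerE/=.
rewrite mulrn_wle0// mulNr oppr_le0 mulr_ge0//.
  by rewrite mulrn_wge0// mulr_ge0// exprn_ge0// mulr_ge0.
by rewrite exprn_ge0// [_ * v]mulrC subr_ge0.
Qed.

Definition exp_poly (P : {poly R}) (m : R) t := P.[expR (m * t)].
Definition exp_poly' (P : {poly R}) (m : R) t := P^`().[expR (m * t)] * (expR (m * t) * m).

Lemma is_derive_horner (P : {poly R}) (x : R) : is_derive x (1:R) (horner P) P^`().[x].
Proof.
apply: DeriveDef; first exact: derivable_horner.
by rewrite -derive1E -derivE.
Qed.

Lemma is_derive_expl (m t : R) : is_derive t (1:R) (fun t => expR (m * t)) (expR (m * t) * m).
Proof.
apply: (is_derive_eq (is_derive1_comp (f := expR) (g := fun t => m * t) _ _)).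
by rewrite /GRing.scale/= mulr1.
Qed.

Lemma is_derive_exp_poly P m t : is_derive t (1:R) (exp_poly P m) (exp_poly' P m t).
Proof. exact: (is_derive1_comp (is_derive_horner P _) (is_derive_expl m t)). Qed.

Lemma is_derive_continuous (f f' : R -> R) :
  (forall t, is_derive t (1:R) f (f' t)) -> continuous f.
Proof. by move=> h t; apply: differentiable_continuous; apply/derivable1_diffP; have [] := h t. Qed.

Lemma continuous_exp_poly' P m : continuous (exp_poly' P m).
Proof.
have c1 := is_derive_continuous (is_derive_expl m).
have c2 := is_derive_continuous (is_derive_exp_poly P^`() m).
move=> t; apply: cvgM; first exact: c2.
by apply: cvgMl; exact: c1.
Qed.

(** The coefficients of [P], as weights of waves at equally spaced spectral
    parameters, multiply the wave at [lam] by the real weight [exp_poly P m]. *)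
Lemma exp_poly_wave (P : {poly R}) (m : R) (lam : C) t :
  \sum_(k < size P) (P`_k)%:C%C * wave (lam - 'i%C * (m * k%:R)%:C%C) t =
  wave lam t * (exp_poly P m t)%:C%C.
Proof.
rewrite /exp_poly horner_coef rmorph_sum mulr_sumr; apply: eq_bigr => k _.
rewrite wave_shift rmorphM/= -expRM_natl [_ * (m * t)]mulrA [k%:R * m]mulrC; ring.
Qed.

End step.

Section filter.
Context {R : realType}.
Local Notation mu := (@lebesgue_measure R).
Local Notation C := R[i].

(** The origin is excepted from the convergence, because both waves have phase 0
    there and the filter cannot tell them apart. *)
Lemma Rintegral_dominated (X l : R) (w : nat -> R -> R) (g : R -> R) :
  (forall n, measurable_fun `[0, X] (w n)) ->
  (forall n t, t \in `[0, X] -> `|w n t| <= 1) ->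
  (forall t, 0 < t -> t <= X -> w n t @[n --> \oo] --> l) ->
  L1R `[0, X] g ->
  \int[mu]_(t in `[0, X]) (w n t * g t) @[n --> \oo] --> l * \int[mu]_(t in `[0, X]) g t.
Proof.
move=> mw w1 wl gi.
have sub : `]0, X] `<=` (`[0, X] : set R).
  by move=> t /=; rewrite !in_itv/= => /andP[/ltW -> ->].
have gi' : L1R `]0, X] g by apply: L1RS gi.
have wgi n : L1R `]0, X] (fun t => w n t * g t).
  apply: (L1R_bmul (M := 1)) => //; first by apply: measurable_funS (mw n).
  by move=> t /sub; exact: w1.
have E (f : R -> R) : L1R `]0, X] f ->
  \int[mu]_(t in `[0, X]) f t = fine (\int[mu]_(t in `]0%R, X]) (f t)%:E)%E.
  by move=> fi; rewrite -Rintegral_itv_obnd_cbnd.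
rewrite -RintegralZl// E; last exact: L1RZl.
under eq_cvg do rewrite E//.
apply: fine_cvg; rewrite fineK; last first.
  by apply: integrable_fin_num => //; exact: L1RZl.
apply: (@dominated_cvg _ _ _ mu `]0, X] _ (fun n t => (w n t * g t)%:E)
  (fun t => (l * g t)%:E) (fun t => `|g t|%:E)) => //.
- by move=> n; exact: measurable_int (wgi n).
- move=> t /=; rewrite in_itv/= => /andP[t0 tX].
  apply: cvg_EFin; first by apply: nearW.
  by apply: cvgMl; exact: wl.
- exact: L1R_norm.
- move=> n t Dt; rewrite lee_fin normrM ler_piMl//.
  by apply: w1; exact: sub.
Qed.

Lemma cint_dominated (X l : R) (w : nat -> R -> R) (f : R -> C) :
  (forall n, measurable_fun `[0, X] (w n)) ->
  (forall n t, t \in `[0, X] -> `|w n t| <= 1) ->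
  (forall t, 0 < t -> t <= X -> w n t @[n --> \oo] --> l) ->
  L1_on `[0, X] f ->
  complex.Re (cint `[0, X] (fun t => (w n t)%:C%C * f t)) @[n --> \oo] -->
    l * complex.Re (cint `[0, X] f) /\
  complex.Im (cint `[0, X] (fun t => (w n t)%:C%C * f t)) @[n --> \oo] -->
    l * complex.Im (cint `[0, X] f).
Proof.
move=> mw w1 wl [fr fi]; split.
  rewrite [X in X @ _ --> _](_ : _ =
      fun n => \int[mu]_(t in `[0, X]) (w n t * complex.Re (f t))).
    exact: Rintegral_dominated.
  by apply/funext => n; apply: eq_Rintegral => t _; rewrite cReM/= mul0r subr0.
rewrite [X in X @ _ --> _](_ : _ =
    fun n => \int[mu]_(t in `[0, X]) (w n t * complex.Im (f t))).
  exact: Rintegral_dominated.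
by apply/funext => n; apply: eq_Rintegral => t _; rewrite cImM/= mul0r addr0.
Qed.

Variables (b1 b2 X : R).
Hypotheses (hb1 : b1 < 0) (hb2 : 0 < b2) (X0 : 0 < X).
Variables (lam : C) (k1 k2 : R -> C).
Hypothesis k1i : L1_on `[0, X] k1.
Hypothesis k2i : L1_on `[0, X] k2.

(** Chosen so that [expR (rate * eta)] reaches 2, the end of the range of
    [step_poly], at the largest phase [b2 * X]. *)
Definition rate : R := ln 2 / (b2 * X).

Let rate0 : 0 < rate.
Proof. by rewrite divr_gt0 ?ln_gt0 ?ltr1n// mulr_gt0. Qed.

Lemma expR_rate2 t : t <= b2 * X -> expR (rate * t) <= 2.
Proof.
have bX : 0 < b2 * X by rewrite mulr_gt0.
move=> tX; rewrite -[leRHS](@lnK R) ?posrE// ler_expR /rate mulrAC ler_pdivrMr//.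
by rewrite ler_wpM2l// ln_ge0// ler1n.
Qed.

(** The right-hand side of one row of the transformation formula: the two columns
    of a kernel enter through their sum only. *)
Definition wave_transform z := cint `[0, X] (fun t => k1 t * wave z (b1 * t) + k2 t * wave z (b2 * t)).

Lemma filtered_wave_transform (P : {poly R}) :
  \sum_(k < size P) (P`_k)%:C%C * wave_transform (lam - 'i%C * (rate * k%:R)%:C%C) =
  cint `[0, X] (fun t => (exp_poly P rate (b1 * t))%:C%C * (k1 t * wave lam (b1 * t))) +
  cint `[0, X] (fun t => (exp_poly P rate (b2 * t))%:C%C * (k2 t * wave lam (b2 * t))).
Proof.
have mX := measurable_itv `[0, X].
have H bb (k : R -> C) : L1_on `[0, X] k ->
  cint `[0, X] (fun t => (exp_poly P rate (bb * t))%:C%C * (k t * wave lam (bb * t))) =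
  \sum_(m < size P) (P`_m)%:C%C * cint `[0, X] (fun t =>
    k t * wave (lam - 'i%C * (rate * m%:R)%:C%C) (bb * t)).
  move=> ki.
  rewrite (@eq_cint _ _ _ (fun t => \sum_(m < size P) (P`_m)%:C%C *
     (k t * wave (lam - 'i%C * (rate * m%:R)%:C%C) (bb * t)))); last first.
    move=> t _; rewrite mulrC -mulrA -exp_poly_wave mulr_sumr.
    by apply: eq_bigr => m _; rewrite mulrCA.
  rewrite cint_sum//; last by move=> m; apply: L1Zl => //; exact: L1_wavemulr.
  by apply: eq_bigr => m _; rewrite cintZl//; exact: L1_wavemulr.
rewrite H// H// -big_split/=; apply: eq_bigr => m _.
by rewrite -mulrDr /wave_transform cintD//; exact: L1_wavemulr.
Qed.

(** The phases of the first column are negative and those of the second one are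
    positive, so the filters [step_poly n] keep the first column and remove the
    second one in the limit. *)
Lemma first_column_bound (B : R) :
  (forall n, cn1 (\sum_(k < size (@step_poly R n)) ((@step_poly R n)`_k)%:C%C *
     wave_transform (lam - 'i%C * (rate * k%:R)%:C%C)) <= B) ->
  cn1 (cint `[0, X] (fun t => k1 t * wave lam (b1 * t))) <= B.
Proof.
move=> hB.
have dom bb t : bb <= b2 -> t \in `[0, X] -> 0 <= expR (rate * (bb * t)) <= 2.
  move=> bb2; rewrite in_itv/= => /andP[t0 tX]; rewrite expR_ge0/= expR_rate2//.
  apply: (@le_trans _ _ (b2 * t)); first by rewrite ler_wpM2r.
  by rewrite ler_wpM2l// ltW.
have mw bb n : measurable_fun `[0, X] (fun t => exp_poly (step_poly n) rate (bb * t)).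
  apply: measurable_funTS; apply: continuous_measurable_fun => t.
  apply: continuous_comp; first by apply: cvgMr; exact: cvg_id.
  exact: (is_derive_continuous (is_derive_exp_poly (step_poly n) rate)).
have w1 bb : bb <= b2 -> forall n t, t \in `[0, X] -> `|exp_poly (step_poly n) rate (bb * t)| <= 1.
  move=> bb2 n t tX; have /andP[s0 s1] := step_poly01 n (dom bb t bb2 tX).
  by rewrite ger0_norm.
have b12 : b1 <= b2 by rewrite ltW// (lt_trans hb1).
have l1 t : 0 < t -> t <= X ->
    exp_poly (step_poly n) rate (b1 * t) @[n --> \oo] --> (1 : R).
  move=> t0 tX; apply: step_poly_cvg1.
  by rewrite expR_ge0/= expR_lt1 pmulr_rlt0// nmulr_rlt0.
have l2 t : 0 < t -> t <= X ->
    exp_poly (step_poly n) rate (b2 * t) @[n --> \oo] --> (0 : R).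
  move=> t0 tX; apply: step_poly_cvg0.
  apply/andP; split.
  by rewrite expR_gt1 mulr_gt0 ?rate0 ?mulr_gt0.
  by apply: expR_rate2; rewrite ler_wpM2l// ltW.
have [r1 i1] := cint_dominated (mw b1) (w1 b1 b12) l1 (L1_wavemulr lam b1 k1i).
have [r2 i2] := cint_dominated (mw b2) (w1 b2 (lexx _)) l2 (L1_wavemulr lam b2 k2i).
pose T n := \sum_(k < size (@step_poly R n)) ((@step_poly R n)`_k)%:C%C *
     wave_transform (lam - 'i%C * (rate * k%:R)%:C%C).
have Tr : complex.Re (T n) @[n --> \oo] --> complex.Re (cint `[0, X] (fun t => k1 t * wave lam (b1 * t))).
  have h := cvgD r1 r2; specialize (h _); rewrite mul1r mul0r addr0 in h.
  apply: cvg_trans h; apply: near_eq_cvg; apply: nearW => n.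
  by rewrite /T filtered_wave_transform cReD.
have Ti : complex.Im (T n) @[n --> \oo] --> complex.Im (cint `[0, X] (fun t => k1 t * wave lam (b1 * t))).
  have h := cvgD i1 i2; specialize (h _); rewrite mul1r mul0r addr0 in h.
  apply: cvg_trans h; apply: near_eq_cvg; apply: nearW => n.
  by rewrite /T filtered_wave_transform cImD.
pose A := cint `[0, X] (fun t => k1 t * wave lam (b1 * t)).
have Tc : (fun n => `|complex.Re (T n)| + `|complex.Im (T n)|) @ \oo -->
    `|complex.Re A| + `|complex.Im A|.
  by apply: cvgD; apply: cvg_norm.
rewrite /cn1 -/A -(cvg_lim (@Rhausdorff R) Tc).
apply: limr_le; first by apply/cvg_ex; eexists; exact: Tc.
by near=> n; exact: hB.
Unshelve. all: by end_near. Qed.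

End filter.

(** * Completeness of L1 *)

Section L1_complete.
Context {R : realType}.
Local Notation mu := (@lebesgue_measure R).

(** Completeness of L1 for sequences whose steps have summable norms. The sum [S]
    of the absolute steps is integrable by monotone convergence, hence finite
    almost everywhere; there the sequence converges, and it is dominated by the
    first term plus [S]. *)
Lemma fast_cauchy_cvg_L1 (a b c : R) (r : nat -> R -> R) :
  (forall k, L1R `[a, b] (r k)) ->
  (forall k, (\int[mu]_(t in `[a, b]) `|r k.+1 t - r k t|%:E <=
    (c / (2 ^ (k + 1))%N%:R)%:E)%E) ->
  exists g, L1R `[a, b] g /\
    (\int[mu]_(t in `[a, b]) `|r k t - g t|%:E)%E @[k --> \oo] --> 0%E.
Proof.
move=> ri rc; pose D := [set` `[a, b]].
have mD : measurable D by exact: measurable_itv.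
pose d k t := `|r k.+1 t - r k t|.
have di k : L1R D (d k) by apply: L1R_norm => //; exact: L1RB.
have md k : measurable_fun D (fun t => (d k t)%:E) by exact: measurable_int (di k).
have d0 k t : D t -> (0 <= (d k t)%:E)%E by by rewrite lee_fin normr_ge0.
pose S t := (\sum_(0 <= k <oo) (d k t)%:E)%E.
have S0 t : (0 <= S t)%E by apply: nneseries_ge0 => k _ _; by rewrite lee_fin normr_ge0.
have mS : measurable_fun D S by apply: ge0_emeasurable_sum => // k t Dt _; exact: d0.
have iS : mu.-integrable D S.
  apply/integrableP; split => //.
  under eq_integral do rewrite gee0_abs//.
  rewrite integral_nneseries//.
  apply: (@le_lt_trans _ _ (\sum_(0 <= k <oo) (c / (2 ^ (k + 1))%N%:R)%:E)%E).
    apply: lee_nneseries => [k _ _|k _]; last exact: rc.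
    by apply: integral_ge0 => t Dt; exact: d0.
  rewrite (cvg_lim _ (@cvg_geometric_eseries_half R c 0)) ?ltry//.
pose G t := (`|r 0%N t|%:E + S t)%E.
have iG : mu.-integrable D G.
  by apply: integrableD => //; exact: (L1R_norm mD (ri 0%N)).
(* The upper limit is measurable without any selection of the points of
   convergence, and equals the limit wherever the latter exists. *)
pose f t := limn_esup (fun k => (r k t)%:E).
have mr k : measurable_fun D (fun t => (r k t)%:E) by exact: measurable_int (ri k).
have mf : measurable_fun D f by exact: measurable_fun_limn_esup.
have part k t : (`|r k t|%:E <= `|r 0%N t|%:E + \sum_(0 <= i < k) (d i t)%:E)%E.
  elim: k => [|k IH]; first by rewrite big_geq// adde0.
  rewrite big_nat_recr//= addeA; apply: (le_trans _ (leeD2r _ IH)).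
  by rewrite -EFinD lee_fin -{1}(subrK (r k t) (r k.+1 t)) addrC ler_normD.
have rG k t : D t -> (`|(r k t)%:E| <= G t)%E.
  move=> Dt; apply: (le_trans (part k t)); apply: leeD2l.
  by apply: nneseries_lim_ge => *; by rewrite lee_fin normr_ge0.
have rf : {ae mu, forall t, D t -> (r k t)%:E @[k --> \oo] --> f t}.
  have [] := integrable_ae _ iS => // N [mN N0 sub]; exists N; split => //.
  apply: subset_trans sub => t /=; apply: contra_not => h Dt.
  have Sfin := h Dt.
  have cr : cvgn (fun k => r k t).
    have cs : cvgn (series (fun k => r k.+1 t - r k t)).
      apply: normed_cvg; apply: nondecreasing_is_cvgn.
        by apply/nondecreasing_seqP => k; rewrite [leRHS]seriesSr lerDl normr_ge0.
      exists (fine (S t)) => _ [k _ <-]; rewrite -lee_fin fineK//.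
      rewrite /series/= -sumEFin; apply: nneseries_lim_ge => *.
      by rewrite lee_fin normr_ge0.
    rewrite (_ : (fun k => r k t) = fun k => r 0%N t + series (fun k => r k.+1 t - r k t) k).
      by apply: is_cvgD => //; exact: is_cvg_cst.
    by apply/funext => k; rewrite /series/= telescope_sumr// addrC subrK.
  have cE : (r k t)%:E @[k --> \oo] --> (limn (fun k => r k t))%:E.
    by apply: cvg_EFin => //; exact: nearW.
  by rewrite /f (cvg_limn_einf_sup cE).2.
have [] := @dominated_convergence _ _ _ mu D _ (fun k t => (r k t)%:E) f G mr mf rf iG => //.
  by apply: nearW => t k; exact: rG.
move=> fi f0 _.
exists (fine \o f); split.
  apply: (le_integrable _ _ _ fi) => //.
    by apply/measurable_EFinP; exact: (measurableT_comp _ mf).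
  by move=> t Dt /=; case: (f t) => [s| |] /=; rewrite ?normr0 ?leey ?lexx.
apply: (@squeeze_cvge _ _ _ _ (fun=> 0%E) _ (fun k => \int[mu]_(t in D) `|(r k t)%:E - f t|)%E).
- apply: nearW => k; apply/andP; split; first exact: integral_ge0.
  apply: ge0_le_integral => //.
  + have mfin : measurable_fun D (fine \o f) by exact: (measurableT_comp _ mf).
    have mrk : measurable_fun D (r k) by apply/measurable_EFinP; exact: mr.
    apply/measurable_EFinP; apply: (measurableT_comp (f := @Num.norm R R)) => //.
    exact: measurable_funB.
  + exact: (measurableT_comp (@abse_measurable R setT) (emeasurable_funB (mr k) mf)).
  + move=> t Dt /=; case: (f t) => [s| |]//=; rewrite leey//.
- exact: cvg_cst.
- exact: f0.
Qed.

End L1_complete.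

(** * Sections of functions on the triangle *)

Section sections.
Context {R : realType}.
Local Notation mu := (@lebesgue_measure R).
Local Notation C := R[i].
Implicit Types (phi psi : R -> C) (f : R * R -> C) (x : R).

Definition absint x phi : \bar R := (\int[mu]_(t in `[0%R, x]) (cabs (phi t))%:E)%E.

Lemma measurable_cabs x phi : cmeasurable `[0, x] phi ->
  measurable_fun `[0, x] (fun t => cabs (phi t)).
Proof.
move=> [m1 m2]; rewrite (_ : (fun _ => _) = fun t => Num.sqrt
  (complex.Re (phi t) * complex.Re (phi t) + complex.Im (phi t) * complex.Im (phi t))).
  apply: (measurableT_comp (f := @Num.sqrt R)).
    by apply: continuous_measurable_fun; exact: sqrt_continuous.
  by apply: measurable_funD; apply: measurable_funM.
by apply/funext => t; rewrite cabs_sqrt !expr2.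
Qed.

Lemma emeasurable_cabs x phi : cmeasurable `[0, x] phi ->
  measurable_fun `[0, x] (fun t => (cabs (phi t))%:E).
Proof. by move=> m; apply/measurable_EFinP; exact: measurable_cabs. Qed.

Lemma absint_ge0 x phi : (0 <= absint x phi)%E.
Proof. by apply: integral_ge0 => t _; rewrite lee_fin cabs_ge0. Qed.

Lemma cabsD (z w : C) : cabs (z + w) <= cabs z + cabs w.
Proof.
have := ler_normD z w; rewrite /cabs.
by case: (`|z + w|) => a b; case: (`|z|) => c d; case: (`|w|) => e f; rewrite lecE/= => /andP[].
Qed.

Lemma cabsN (z : C) : cabs (- z) = cabs z.
Proof. by rewrite /cabs normrN. Qed.

Lemma cmeasurableN x phi : cmeasurable `[0, x] phi -> cmeasurable `[0, x] (fun t => - phi t).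
Proof.
move=> m; apply: (cmeasurable_eq (f := fun t => (-1) * phi t)).
  by move=> t _; rewrite mulN1r.
by apply: cmeasurableM => //; exact: cmeasurable_cst.
Qed.

Lemma cmeasurableB x phi psi : cmeasurable `[0, x] phi -> cmeasurable `[0, x] psi ->
  cmeasurable `[0, x] (fun t => phi t - psi t).
Proof. by move=> m1 m2; apply: cmeasurableD => //; exact: cmeasurableN. Qed.

Lemma absintD x phi psi : cmeasurable `[0, x] phi -> cmeasurable `[0, x] psi ->
  (absint x (fun t => phi t + psi t)%R <= absint x phi + absint x psi)%E.
Proof.
move=> m1 m2; rewrite /absint -ge0_integralD//=; last 4 first.
- by move=> t _; rewrite lee_fin cabs_ge0.
- exact: emeasurable_cabs.
- by move=> t _; rewrite lee_fin cabs_ge0.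
- exact: emeasurable_cabs.
apply: ge0_le_integral => //.
- by move=> t _; rewrite lee_fin cabs_ge0.
- by apply: emeasurable_cabs; exact: cmeasurableD.
- by apply: emeasurable_funD; exact: emeasurable_cabs.
- by move=> t _; rewrite -EFinD lee_fin cabsD.
Qed.

Lemma absintN x phi : absint x (fun t => - phi t) = absint x phi.
Proof. by apply: eq_integral => t _; rewrite cabsN. Qed.

Lemma absint_triangle x phi psi chi :
  cmeasurable `[0, x] phi -> cmeasurable `[0, x] psi -> cmeasurable `[0, x] chi ->
  (absint x (fun t => phi t - chi t)%R <=
   absint x (fun t => phi t - psi t)%R + absint x (fun t => psi t - chi t)%R)%E.
Proof.
move=> m1 m2 m3; rewrite (_ : (fun t => phi t - chi t) =
  fun t => (phi t - psi t) + (psi t - chi t)).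
  by apply: absintD; exact: cmeasurableB.
by apply/funext => t; rewrite addrA subrK.
Qed.

Lemma absint_sym x phi psi : absint x (fun t => phi t - psi t) = absint x (fun t => psi t - phi t).
Proof. by rewrite -absintN; congr absint; apply/funext => t; rewrite opprB. Qed.

Lemma absint_eq0 x phi : cmeasurable `[0, x] phi -> absint x phi = 0%E ->
  {ae mu, forall t, t \in `[0, x] -> phi t = 0}.
Proof.
move=> m n0.
have m' := emeasurable_cabs m.
have : (\int[mu]_(t in `[0%R, x]) `|(cabs (phi t))%:E| = 0)%E.
  by rewrite -[RHS]n0; apply: eq_integral => t _; rewrite gee0_abs// lee_fin cabs_ge0.
move/(ae_eq_integral_abs mu _ m') => /(_ (measurable_itv _)) [N [mN N0 sub]].
exists N; split => //; apply: subset_trans sub => t /=; apply: contra_not => h tx.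
have [] := h tx => c0.
have : cn1 (phi t) <= 0 by rewrite (le_trans (cn1_le_cabs _))// c0 mulr0.
rewrite le_eqVlt ltNge cn1_ge0 orbF paddr_eq0// !normr_eq0 => /andP[/eqP h1 /eqP h2].
exact: complexP.
Qed.

Lemma measurable_Omega_set : measurable (@Omega R).
Proof.
rewrite (_ : Omega = [set p : R * R | 0 <= p.2] `&` [set p | p.2 <= p.1] `&` [set p | p.1 <= 1]); last first.
  apply/seteqP; split => p; rewrite /Omega/=; first by move=> [/andP[]].
  by move=> [[h1 h2] h3]; split => //; apply/andP.
apply: measurableI; first apply: measurableI.
- rewrite (_ : [set p : R * R | 0 <= p.2] = snd @^-1` `[0, +oo[).
    by rewrite -[X in measurable X]setTI; apply: (@measurable_snd _ _ R R).
  by apply/seteqP; split => p /=; rewrite in_itv/= andbT.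
- rewrite (_ : [set p : R * R | p.2 <= p.1] = (fun p : R * R => p.1 - p.2) @^-1` `[0, +oo[).
    rewrite -[X in measurable X]setTI.
    by apply: (measurable_funB (@measurable_fst _ _ R R) (@measurable_snd _ _ R R)).
  by apply/seteqP; split => p /=; rewrite in_itv/= andbT subr_ge0.
- rewrite (_ : [set p : R * R | p.1 <= 1] = fst @^-1` `]-oo, 1]).
    by rewrite -[X in measurable X]setTI; apply: (@measurable_fst _ _ R R).
  by apply/seteqP; split => p /=; rewrite in_itv.
Qed.

(** Common to the functions measurable on [Omega] and to those continuous there,
    this is what additivity of the norm requires. *)
Definition section_measurable f := forall x, x \in `[0, 1] -> cmeasurable `[0, x] (fun t => f (x, t)).

Lemma sect_sub x : x \in `[0, 1] -> [set (x, t) | t in `[0, x]] `<=` (@Omega R).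
Proof.
rewrite in_itv/= => /andP[x0 x1] _ [t tx <-]; have : t \in `[0, x] by exact: tx.
rewrite in_itv/= => /andP[t0 {}tx].
by rewrite /Omega/= t0 tx.
Qed.

Lemma measurable_Omega_sect f : measurable_Omega f -> section_measurable f.
Proof.
move=> [m1 m2] x x1; split.
  apply: (measurable_comp measurable_Omega_set (sect_sub x1) m1).
  by apply: measurable_funTS; exact: pair1_measurable.
apply: (measurable_comp measurable_Omega_set (sect_sub x1) m2).
by apply: measurable_funTS; exact: pair1_measurable.
Qed.

Lemma within_sect (g : R * R -> R) x : x \in `[0, 1] ->
  {within Omega, continuous g} -> {within `[0, x], continuous (fun t => g (x, t))}.
Proof.
move=> x1 /subspace_continuousP cg; apply/subspace_continuousP => t tx.
have Ot : Omega (x, t) by apply: (sect_sub x1); exists t.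
apply: (cvg_comp (fun t => (x, t)) g _ (cg _ Ot)).
move=> U; rewrite /within/= => HU.
have : nbhs (x, t) [set p | Omega p -> U p] by exact: HU.
have ct : (fun s => (x, s)) @ t --> (x, t).
  by apply: (@cvg_pair _ _ _ (nbhs t) (nbhs x) (nbhs t)); [exact: cvg_cst|exact: cvg_id].
move=> /ct h2.
have {}h2 : \forall s \near t, Omega (x, s) -> U (x, s) by exact: h2.
have : \forall s \near t, s \in `[0, x] -> U (x, s).
  apply: filterS h2 => s h sx; apply: h.
  by apply: (sect_sub x1); exists s.
by [].
Qed.

Lemma L1_sect f x : x \in `[0, 1] -> continuous_Omega f -> L1_on `[0, x] (fun t => f (x, t)).
Proof.
move=> x1 [c1 c2]; split.
  by apply: continuous_compact_integrable; [exact: segment_compact|exact: (within_sect x1 c1)].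
by apply: continuous_compact_integrable; [exact: segment_compact|exact: (within_sect x1 c2)].
Qed.

Lemma continuous_Omega_sect f : continuous_Omega f -> section_measurable f.
Proof. by move=> cf x x1; apply: L1_cmeasurable => //; exact: L1_sect. Qed.

Lemma continuous_OmegaB f g : continuous_Omega f -> continuous_Omega g ->
  continuous_Omega (fun p => f p - g p).
Proof.
move=> [f1 f2] [g1 g2]; split => p.
  rewrite (_ : (fun _ => _) = fun p => complex.Re (f p) - complex.Re (g p)).
    by apply: cvgB; [exact: f1|exact: g1].
  by apply/funext => q; rewrite cReD cReN.
rewrite (_ : (fun _ => _) = fun p => complex.Im (f p) - complex.Im (g p)).
  by apply: cvgB; [exact: f2|exact: g2].
by apply/funext => q; rewrite cImD cImN.
Qed.

Lemma section_measurableB f g : section_measurable f -> section_measurable g -> section_measurable (fun p => f p - g p).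
Proof. by move=> mf mg x x1; apply: cmeasurableB; [exact: mf|exact: mg]. Qed.

Lemma norm_Xinf1E f : norm_Xinf1 f = ess_sup mu ((fun x => absint x (fun t => f (x, t))) \_ `[0, 1]).
Proof. by []. Qed.

Lemma norm_Xinf1D f g : section_measurable f -> section_measurable g ->
  (norm_Xinf1 (fun p => f p + g p)%R <= norm_Xinf1 f + norm_Xinf1 g)%E.
Proof.
move=> mf mg; rewrite !norm_Xinf1E.
apply: (le_trans _ (ess_supD _ _ _)); apply: le_ess_sup; apply: nearW => x /=.
rewrite !patchE; case: ifPn => [/set_mem/= x1|_]; last by rewrite adde0.
by apply: absintD; [exact: mf|exact: mg].
Qed.

Lemma norm_Xinf1N f : norm_Xinf1 (fun p => - f p) = norm_Xinf1 f.
Proof.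
rewrite !norm_Xinf1E; congr ess_sup; apply/funext => x; rewrite !patchE.
by case: ifPn => // _; rewrite absintN.
Qed.

Lemma norm_Xinf1_sym f g : norm_Xinf1 (fun p => f p - g p) = norm_Xinf1 (fun p => g p - f p).
Proof. by rewrite -norm_Xinf1N; congr norm_Xinf1; apply/funext => p; rewrite opprB. Qed.

Lemma norm_Xinf1_triangle f g h : section_measurable f -> section_measurable g -> section_measurable h ->
  (norm_Xinf1 (fun p => f p - h p)%R <=
   norm_Xinf1 (fun p => f p - g p)%R + norm_Xinf1 (fun p => g p - h p)%R)%E.
Proof.
move=> mf mg mh; rewrite (_ : (fun p => f p - h p) = fun p => (f p - g p) + (g p - h p)).
  by apply: norm_Xinf1D; exact: section_measurableB.
by apply/funext => t; rewrite addrA subrK.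
Qed.

Lemma null_dense (N : set R) (a b : R) : measurable N -> mu N = 0%E -> a < b ->
  exists x, [/\ a < x, x < b & ~ N x].
Proof.
move=> mN N0 ab; apply: contrapT => h.
have sub : `]a, b[ `<=` N.
  move=> x /=; rewrite in_itv/= => /andP[ax xb]; apply: contrapT => nx.
  by apply: h; exists x.
have : (mu `]a, b[%classic <= mu N)%E by apply: le_measure; rewrite ?inE.
by rewrite N0 lebesgue_measure_itv/= lte_fin ab -EFinD lee_fin leNgt subr_gt0 ab.
Qed.

Lemma limn_einf_le (u : (\bar R)^nat) (M : \bar R) :
  (forall n, (u n <= M)%E) -> (limn_einf u <= M)%E.
Proof.
move=> uM; rewrite limn_einf_lim; apply: lime_le; first exact: is_cvg_einfs.
apply: nearW => n; apply: le_trans (uM n); apply: ereal_inf_lbound.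
by exists n => /=.
Qed.

(** For a continuous function the essential supremum bounds the section at every
    point [x], by Fatou's lemma along points [s n] that increase to [x] and avoid
    the exceptional null set. *)
Lemma absint_le_norm_Xinf1 f x : continuous_Omega f -> x \in `[0, 1] ->
  (absint x (fun t => f (x, t)) <= norm_Xinf1 f)%E.
Proof.
move=> cf x1; have [x0 xle1] : 0 <= x /\ x <= 1 by move: x1; rewrite in_itv => /andP.
rewrite norm_Xinf1E; set g := (_ \_ _).
have [N [mN N0 sub]] := ess_sup_ge mu g.
have good s : 0 <= s -> s <= 1 -> ~ N s -> (absint s (fun t => f (s, t)) <= ess_sup mu g)%E.
  move=> s0 s1 Ns; have : (g s <= ess_sup mu g)%E by apply: contrapT => h; apply: Ns; exact: sub.
  by rewrite /g patchE mem_set//= in_itv/= s0.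
have [x_gt0|] := ltP 0 x; last first.
  move=> xle0; have -> : x = 0 by apply/eqP; rewrite eq_le xle0.
  have [s [s0 s1 Ns]] := null_dense mN N0 (ltr01).
  rewrite {1}/absint set_itv1 integral_set1; apply: le_trans (good s (ltW s0) (ltW s1) Ns).
  exact: absint_ge0.
have : forall n, exists s, [/\ x - x / n.+1%:R < s, s < x & ~ N s].
  by move=> n; apply: null_dense => //; rewrite gtrBl divr_gt0.
move=> /choice[s sP].
have s0 n : 0 <= s n.
  have [h _ _] := sP n; apply: le_trans (ltW h); rewrite subr_ge0 ler_pdivrMr//.
  by rewrite ler_peMr// ler1n.
have sx n : s n < x by have [] := sP n.
have sl : s n @[n --> \oo] --> x.
  apply: (@squeeze_cvgr _ _ _ _ (fun n => x - x / n.+1%:R) (fun=> x)).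
  - by apply: nearW => n; have [/ltW-> /ltW->] := sP n.
  - rewrite -[X in _ --> X]subr0; apply: cvgB; first exact: cvg_cst.
    rewrite -[X in _ --> X](mulr0 x); apply: cvgMr.
    exact: cvg_harmonic.
  - exact: cvg_cst.
have s1 n : s n \in `[0, 1] by rewrite in_itv/= s0 (le_trans (ltW (sx n))).
have mf := continuous_Omega_sect cf.
pose phi n : R -> \bar R := (fun t => (cabs (f (s n, t)))%:E) \_ `[0, s n].
have mphi n : measurable_fun `]0, x[ (phi n).
  apply/measurable_restrict => //; apply: measurable_funS (emeasurable_cabs (mf _ (s1 n))) => //.
have phi0 n t : (0 <= phi n t)%E.
  by rewrite /phi patchE; case: ifPn => // _; rewrite lee_fin cabs_ge0.
have phil t : `]0, x[%classic t -> phi n t @[n --> \oo] --> (cabs (f (x, t)))%:E.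
  rewrite /= in_itv/= => /andP[t0 tx].
  have Oxt : Omega (x, t) by rewrite /Omega/= (ltW t0) (ltW tx).
  have cvO (k : R * R -> R) : {within Omega, continuous k} ->
      k (s n, t) @[n --> \oo] --> k (x, t).
    move=> /subspace_continuousP/(_ _ Oxt) cg; apply: cvg_comp cg.
    move=> U; rewrite /within/= => HU.
    have cst_ : (s n, t) @[n --> \oo] --> (x, t).
      by apply: (@cvg_pair _ _ _ \oo (nbhs x) (nbhs t)) => //; exact: cvg_cst.
    have : \forall n \near \oo, t < s n by exact: (cvgr_gt _ sl).
    move=> tsn; have h2 : \forall n \near \oo, Omega (s n, t) -> U (s n, t).
      by have h := cst_ _ HU; exact: h.
    have h3 : \forall n \near \oo, U (s n, t).
      apply: filterS2 tsn h2 => n tsn; apply.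
      by rewrite /Omega/= (ltW t0) (ltW tsn); have := s1 n; rewrite in_itv => /andP[].
    exact: h3.
  have lr := cvO _ cf.1; have li := cvO _ cf.2.
  apply: (@cvg_trans _ (EFin \o (fun n => cabs (f (s n, t))) @ \oo)).
    apply: near_eq_cvg; near=> n; rewrite /phi patchE mem_set//= in_itv/= (ltW t0)/=.
    by apply: ltW; near: n; exact: (cvgr_gt _ sl).
  apply: cvg_EFin; first by apply: nearW.
  have E z : cabs z = Num.sqrt (complex.Re z * complex.Re z + complex.Im z * complex.Im z) :> R.
    by rewrite cabs_sqrt !expr2.
  rewrite [X in _ --> X]E (_ : fine \o _ = fun n => Num.sqrt
    (complex.Re (f (s n, t)) * complex.Re (f (s n, t)) +
     complex.Im (f (s n, t)) * complex.Im (f (s n, t)))); last first.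
    by apply/funext => n; rewrite /= E.
  apply: (cvg_comp _ (@Num.sqrt R)); last exact: sqrt_continuous.
  by apply: cvgD; apply: cvgM.
have mx := emeasurable_cabs (mf _ x1).
have -> : absint x (fun t => f (x, t)) =
    (\int[mu]_(t in `]0%R, x[) (cabs (f (x, t)))%:E)%E.
  rewrite /absint -integral_itv_bndo_bndc//; last by apply: measurable_funS mx => //; apply: subset_itvl; rewrite bnd_simp.
  rewrite -integral_itv_obnd_cbnd//; apply: measurable_funS mx => //.
  exact: subset_itv_oo_cc.
have -> : (\int[mu]_(t in `]0%R, x[) (cabs (f (x, t)))%:E =
    \int[mu]_(t in `]0%R, x[) limn_einf (phi ^~ t))%E.
  by apply: eq_integral => t /set_mem tx; rewrite (cvg_limn_einf_sup (phil t tx)).1.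
apply: (le_trans (fatou mu _ mphi (fun n t _ => phi0 n t))) => //.
apply: limn_einf_le => n.
have sn1 : s n <= 1 by have := s1 n; rewrite in_itv => /andP[].
have [_ _ nN] := sP n.
rewrite /phi -integral_mkcondr; apply: le_trans (good (s n) (s0 n) sn1 nN).
apply: ge0_subset_integral => //.
- exact: measurableI.
- exact: emeasurable_cabs (mf _ (s1 n)).
- by move=> t _; rewrite lee_fin cabs_ge0.
Unshelve. all: by end_near. Qed.

End sections.

(** * Traces *)

Section traces.
Context {R : realType}.
Local Notation mu := (@lebesgue_measure R).
Local Notation C := R[i].
Implicit Types (f : R * R -> C) (x : R) (h : nat -> R * R -> C).

Lemma norm_Xinf1_ge0 f : (0 <= norm_Xinf1 f)%E.
Proof.
rewrite norm_Xinf1E; apply: ess_sup_gee.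
  apply: (@lt_le_trans _ _ (mu `]0, 1[%classic)).
    by rewrite lebesgue_measure_itv/= lte_fin ltr01 -EFinD lte_fin subr0 ltr01.
  by apply: le_measure; rewrite ?inE.
apply: nearW => x; rewrite patchE; case: ifPn => // _; exact: absint_ge0.
Qed.

Lemma cvge0_lt (u : (\bar R)^nat) (e : R) : u n @[n --> \oo] --> 0%E -> 0 < e ->
  exists n, (u n <= e%:E)%E.
Proof.
move=> u0 e0; have nb : nbhs 0%E [set y : \bar R | (y < e%:E)%E].
  apply: open_nbhs_nbhs; split; first exact: open_ereal_lt_ereal.
  by rewrite /= lte_fin.
have : \forall n \near \oo, (u n < e%:E)%E by exact: (u0 _ nb).
by move=> [n _ /(_ n (leqnn n))/ltW h]; exists n.
Qed.

Lemma cvge0D (u v : (\bar R)^nat) : u n @[n --> \oo] --> 0%E ->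
  v n @[n --> \oo] --> 0%E -> (u n + v n)%E @[n --> \oo] --> 0%E.
Proof. by move=> u0 v0; rewrite -[X in _ --> X]adde0; exact: cvgeD. Qed.

(** Two continuous approximations of [f] are close on every section, including
    those on which [f] itself is not controlled. *)
Lemma approx_sub f h x n : measurable_Omega f -> approximates norm_Xinf1 h f ->
  forall k h', (forall m, continuous_Omega (h' m)) -> x \in `[0, 1] ->
  (absint x (fun t => h' k (x, t) - h n (x, t))%R <=
    norm_Xinf1 (fun p => f p - h' k p)%R + norm_Xinf1 (fun p => f p - h n p)%R)%E.
Proof.
move=> mf [ch _] k h' ch' x1.
apply: (le_trans (absint_le_norm_Xinf1 (continuous_OmegaB (ch' k) (ch n)) x1)).
rewrite [X in (_ <= X + _)%E]norm_Xinf1_sym.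
apply: norm_Xinf1_triangle; [exact: continuous_Omega_sect|exact: measurable_Omega_sect|exact: continuous_Omega_sect].
Qed.

Lemma Re_le_cabs (z : C) : `|complex.Re z| <= cabs z.
Proof. by rewrite cabs_sqrt -sqrtr_sqr ler_wsqrtr// lerDl sqr_ge0. Qed.

Lemma Im_le_cabs (z : C) : `|complex.Im z| <= cabs z.
Proof. by rewrite cabs_sqrt -sqrtr_sqr ler_wsqrtr// lerDr sqr_ge0. Qed.

Lemma cReB (z w : C) : complex.Re (z - w) = complex.Re z - complex.Re w.
Proof. by rewrite cReD cReN. Qed.

Lemma cImB (z w : C) : complex.Im (z - w) = complex.Im z - complex.Im w.
Proof. by rewrite cImD cImN. Qed.

(** A subsequence [s k] of an approximating sequence has summable steps on the
    section at [x], so it converges in L1; every other approximating sequence has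
    the same limit by [approx_sub]. *)
Lemma trace_exists f x : X0_inf1 f -> x \in `[0, 1] -> exists g, is_trace f x g.
Proof.
move=> [mf [h [ch hf]]] x1.
have : forall k, exists n, (norm_Xinf1 (fun p => f p - h n p)%R <= (1 / (2 ^ (k + 1))%N%:R)%:E)%E.
  by move=> k; apply: cvge0_lt hf _; rewrite divr_gt0// ltr0n expn_gt0.
move=> /choice[s sP]; pose u k t := h (s k) (x, t).
have ui k : L1_on `[0, x] (u k) by exact: (L1_sect x1 (ch (s k))).
have u_meas k : cmeasurable `[0, x] (u k) by apply: L1_cmeasurable.
have du k : (absint x (fun t => u k.+1 t - u k t)%R <= (2 / (2 ^ (k + 1))%N%:R)%:E)%E.
  apply: (le_trans (approx_sub (s k) mf (conj ch hf) (s k.+1) ch x1)).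
  apply: (le_trans (leeD (sP k.+1) (sP k))); rewrite -EFinD lee_fin.
  rewrite (_ : 2 / _ = 1 / (2 ^ (k + 1))%:R + 1 / (2 ^ (k + 1))%:R); last by rewrite -mulrDl.
  rewrite lerD2r ler_wpM2l// lef_pV2 ?posrE ?ltr0n ?expn_gt0//.
  by rewrite ler_nat leq_exp2l// leq_add2r.
(* [p] stands for the real or for the imaginary part *)
have dr (p : C -> R) : (forall z, `|p z| <= cabs z) -> (forall z w, p (z - w) = p z - p w) ->
    (forall k, L1R `[0, x] (fun t => p (u k t))) ->
    exists g, L1R `[0, x] g /\
    (\int[mu]_(t in `[0%R, x]) `|p (u k t) - g t|%:E)%E @[k --> \oo] --> 0%E.
  move=> pc pB pi; apply: (fast_cauchy_cvg_L1 (c := 2)) => // k.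
  apply: le_trans (du k); apply: ge0_le_integral => //.
  - apply: (measurable_int mu (L1R_norm _ (L1RB _ (pi k.+1) (pi k)))) => //.
  - by apply: emeasurable_cabs; exact: cmeasurableB.
  - by move=> t _; rewrite lee_fin -pB.
have [gr [gri grl]] := dr (@complex.Re R) Re_le_cabs cReB
  (fun k => (ui k).1).
have [gi [gii gil]] := dr (@complex.Im R) Im_le_cabs cImB
  (fun k => (ui k).2).
pose g t := Complex (gr t) (gi t).
have Lg : L1_on `[0, x] g by split.
have mg : cmeasurable `[0, x] g by exact: L1_cmeasurable.
have ug : absint x (fun t => u k t - g t) @[k --> \oo] --> 0%E.
  apply: (@squeeze_cvge _ _ _ _ (fun=> 0%E) _ (fun k =>
     (\int[mu]_(t in `[0%R, x]) `|complex.Re (u k t) - gr t|%:E +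
      \int[mu]_(t in `[0%R, x]) `|complex.Im (u k t) - gi t|%:E)%E)).
  - apply: nearW => k; rewrite absint_ge0/= -ge0_integralD//; last 2 first.
    + by apply: (measurable_int mu (L1R_norm _ (L1RB _ (ui k).1 gri))).
    + by apply: (measurable_int mu (L1R_norm _ (L1RB _ (ui k).2 gii))).
    apply: ge0_le_integral => //.
    + by move=> t _; rewrite lee_fin cabs_ge0.
    + by apply: emeasurable_cabs; exact: cmeasurableB.
    + apply: emeasurable_funD.
        by apply: (measurable_int mu (L1R_norm _ (L1RB _ (ui k).1 gri))).
      by apply: (measurable_int mu (L1R_norm _ (L1RB _ (ui k).2 gii))).
    + move=> t _; rewrite -EFinD lee_fin (le_trans (cabs_le_cn1 _))//.
      by rewrite /cn1 cReD cReN cImD cImN.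
  - exact: cvg_cst.
  - exact: cvge0D.
exists g; split => // h' [ch' h'f].
have key n : (absint x (fun t => h' n (x, t) - g t)%R <= norm_Xinf1 (fun p => f p - h' n p)%R)%E.
  pose D := norm_Xinf1 (fun p => f p - h' n p).
  have lim0 : (D + ((k.+1%:R^-1)%:E + absint x (fun t => u k t - g t)%R))%E @[k --> \oo] --> D.
    rewrite -[X in _ --> X]adde0; apply: cvgeD; [by rewrite fin_num_adde_defl|exact: cvg_cst|].
    rewrite -[X in _ --> X]adde0; apply: cvgeD => //.
    by apply: cvg_EFin; [exact: nearW|exact: cvg_harmonic].
  apply: (cvge_to_ge lim0); apply: nearW => k.
  have m' := continuous_Omega_sect (ch' n) x1.
  apply: (le_trans (absint_triangle m' (u_meas k) mg)).
  rewrite [leRHS]addeA; apply: leeD => //.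
  apply: (le_trans (approx_sub (s k) mf (conj ch hf) n ch' x1)); apply: leeD => //.
  apply: (le_trans (sP k)); rewrite lee_fin div1r lef_pV2 ?posrE ?ltr0n ?expn_gt0//.
  by rewrite ler_nat addn1 ltnW// ltn_expl.
apply: (@squeeze_cvge _ _ _ _ (fun=> 0%E) _ (fun n => norm_Xinf1 (fun p => f p - h' n p))).
- by apply: nearW => n; rewrite absint_ge0 key.
- exact: cvg_cst.
- exact: h'f.
Qed.

Lemma trace_unique f x g1 g2 : X0_inf1 f -> x \in `[0, 1] ->
  is_trace f x g1 -> is_trace f x g2 ->
  {ae mu, forall t, t \in `[0, x] -> g1 t = g2 t}.
Proof.
move=> [mf [h hf]] x1 [L1 t1] [L2 t2].
have m1 := L1_cmeasurable (measurable_itv _) L1; have m2 := L1_cmeasurable (measurable_itv _) L2.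
have mh n : cmeasurable `[0, x] (fun t => h n (x, t)).
  by apply: (continuous_Omega_sect (hf.1 n)).
have n0 : absint x (fun t => g1 t - g2 t) = 0%E.
  apply/eqP; rewrite eq_le absint_ge0 andbT.
  have l : (absint x (fun t => h n (x, t) - g1 t)%R + absint x (fun t => h n (x, t) - g2 t)%R)%E
      @[n --> \oo] --> 0%E.
    exact: (cvge0D (t1 _ hf) (t2 _ hf)).
  apply: (cvge_to_ge l); apply: nearW => n.
  by rewrite [X in (_ <= X + _)%E]absint_sym; exact: absint_triangle.
have := absint_eq0 (cmeasurableB m1 m2) n0 => -[N [mN N0 sub]]; exists N; split => //.
apply: subset_trans sub => t /=; apply: contra_not => e tx.
by apply/eqP; rewrite -subr_eq0 e.
Qed.

Lemma traceB f f' x g g' : X0_inf1 f -> X0_inf1 f' -> x \in `[0, 1] ->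
  is_trace f x g -> is_trace f' x g' ->
  X0_inf1 (fun p => f p - f' p) /\ is_trace (fun p => f p - f' p) x (fun t => g t - g' t).
Proof.
move=> [mf [h hf]] [mf' [h' h'f']] x1 [Lg tg] [Lg' tg'].
have mg := L1_cmeasurable (measurable_itv _) Lg; have mg' := L1_cmeasurable (measurable_itv _) Lg'.
have sf := measurable_Omega_sect mf; have sf' := measurable_Omega_sect mf'.
have sh n := continuous_Omega_sect (hf.1 n).
have sh' n := continuous_Omega_sect (h'f'.1 n).
have mD : measurable_Omega (fun p => f p - f' p).
  case: mf mf' => m1 m2 [m3 m4]; split.
    rewrite (_ : (fun _ => _) = (fun p => complex.Re (f p)) \- (fun p => complex.Re (f' p))).
      exact: measurable_funB.
    by apply/funext => p /=; rewrite cReD cReN.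
  rewrite (_ : (fun _ => _) = (fun p => complex.Im (f p)) \- (fun p => complex.Im (f' p))).
    exact: measurable_funB.
  by apply/funext => p /=; rewrite cImD cImN.
have aD : approximates norm_Xinf1 (fun n p => h n p - h' n p) (fun p => f p - f' p).
  split; first by move=> n; apply: continuous_OmegaB; [exact: hf.1|exact: h'f'.1].
  apply: (@squeeze_cvge _ _ _ _ (fun=> 0%E) _ (fun n =>
    (norm_Xinf1 (fun p => f p - h n p)%R + norm_Xinf1 (fun p => f' p - h' n p)%R)%E)).
  - apply: nearW => n; rewrite norm_Xinf1_ge0/= -[X in (_ <= _ + X)%E]norm_Xinf1N.
    rewrite (_ : (fun p => f p - f' p - (h n p - h' n p)) =
      fun p => (f p - h n p) + - (f' p - h' n p)); last by apply/funext => p; ring.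
    apply: norm_Xinf1D; first exact: section_measurableB.
    by move=> y y1; apply: cmeasurableN; exact: section_measurableB.
  - exact: cvg_cst.
  - exact: (cvge0D hf.2 h'f'.2).
split; first by split => //; exists (fun n p => h n p - h' n p).
split; first exact: L1B.
move=> k [ck kD].
apply: (@squeeze_cvge _ _ _ _ (fun=> 0%E) _ (fun n =>
  (norm_Xinf1 (fun p => (f p - f' p) - k n p)%R +
   norm_Xinf1 (fun p => (f p - f' p) - (h n p - h' n p))%R +
   (absint x (fun t => h n (x, t) - g t)%R + absint x (fun t => h' n (x, t) - g' t)%R))%E)).
- apply: nearW => n; rewrite absint_ge0/=.
  have mk := continuous_Omega_sect (ck n) x1.
  have mhh := cmeasurableB (sh n x x1) (sh' n x x1).
  apply: (le_trans (absint_triangle mk mhh (cmeasurableB mg mg'))); apply: leeD.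
    exact: (approx_sub n mD aD n ck x1).
  rewrite -[X in (_ <= _ + X)%E]absintN.
  rewrite (_ : (fun t => h n (x, t) - h' n (x, t) - (g t - g' t)) =
    fun t => (h n (x, t) - g t) + - (h' n (x, t) - g' t)); last by apply/funext => t; ring.
  apply: absintD; first by apply: cmeasurableB => //; exact: sh.
  by apply: cmeasurableN; apply: cmeasurableB => //; exact: sh'.
- exact: cvg_cst.
- apply: cvge0D; first exact: (cvge0D kD aD.2).
  exact: (cvge0D (tg _ hf) (tg' _ h'f')).
Qed.

Lemma trace_atP f x : X0_inf1 f -> x \in `[0, 1] -> is_trace f x (trace_at f x).
Proof. by move=> Xf x1; apply: xgetPex; exact: trace_exists. Qed.

(** The trace of a difference is chosen independently of the traces of the two
    terms, so it agrees with their difference only almost everywhere. *)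
Lemma trace_atB f f' x : X0_inf1 f -> X0_inf1 f' -> x \in `[0, 1] ->
  [/\ L1_on `[0, x] (trace_at f x), L1_on `[0, x] (trace_at f' x),
      L1_on `[0, x] (trace_at (fun p => f p - f' p) x) &
  {ae mu, forall t, t \in `[0, x] ->
    trace_at (fun p => f p - f' p) x t = trace_at f x t - trace_at f' x t}].
Proof.
move=> Xf Xf' x1; have t := trace_atP Xf x1; have t' := trace_atP Xf' x1.
have [XD tD] := traceB Xf Xf' x1 t t'.
have tD' := trace_atP XD x1.
by split; [exact: t.1|exact: t'.1|exact: tD'.1|exact: (trace_unique XD x1 tD' tD)].
Qed.

End traces.

(** * From solutions to kernels *)

Section assembly.
Context {R : realType}.
Local Notation mu := (@lebesgue_measure R).
Local Notation C := R[i].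

Lemma L1R_cabs (x : R) (f : R -> C) : L1_on `[0, x] f -> L1R `[0, x] (fun t => cabs (f t)).
Proof.
move=> fi; apply: (le_integrable _ _ _ (L1_cn1 _ fi)) => //.
  by apply: emeasurable_cabs; exact: L1_cmeasurable.
by move=> t _; rewrite /= lee_fin !ger0_norm ?cabs_ge0 ?cn1_ge0// cabs_le_cn1.
Qed.

Lemma cabs_le_sup_int (x s : R) (f : R -> C) : L1_on `[0, x] f -> s \in `[0, x] ->
  cabs (cint `[0, s] f) <= sup_int x f.
Proof.
move=> fi sx; apply: ub_le_sup; last by exists s.
exists (\int[mu]_(t in `[0, x]) cn1 (f t)) => _ [t tx <-].
by rewrite (le_trans (cabs_le_cn1 _))// cn1_cint_le.
Qed.

Lemma sup_int_ge0 (x : R) (f : R -> C) : 0 <= sup_int x f.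
Proof.
rewrite /sup_int; set S := (X in sup X).
have [hS|nS] := pselect (has_sup S); last by rewrite sup_out.
have [_ [t tx _]] := hS.1; apply: (le_trans (cabs_ge0 (cint `[0, t] f))).
by apply: ub_le_sup; [exact: hS.2|exists t].
Qed.

(** A factor 2 for the difference of the integrals from 0, and another one for the
    passage from the modulus to [cn1]. *)
Lemma cn1_cint_sup_int (x s t : R) (f : R -> C) : L1_on `[0, x] f ->
  0 <= s -> s <= t -> t <= x -> cn1 (cint `[s, t] f) <= 4 * sup_int x f.
Proof.
move=> fi s0 st tx.
have fit : L1_on `[0, t] f by apply: L1_itvS fi.
have h r : r \in `[0, x] -> cn1 (cint `[0, r] f) <= 2 * sup_int x f.
  by move=> rx; rewrite (le_trans (cn1_le_cabs _))// ler_wpM2l// cabs_le_sup_int.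
rewrite (cint_tail fit); last by rewrite in_itv/= s0.
rewrite (le_trans (cn1D _ _))// cn1N (_ : 4 = 2 + 2); last by ring.
rewrite mulrDl; apply: lerD; apply: h; rewrite in_itv/=.
  by rewrite tx (le_trans s0).
by rewrite s0 (le_trans st).
Qed.

Variables (b1 b2 : R).
Hypotheses (hb1 : b1 < 0) (hb2 : 0 < b2).
Local Notation b := (bcoef b1 b2).
Local Notation kap j := (b (rev_ord j) - b j).

Definition offdiag (Q : R -> 'M[C]_2) (j : 'I_2) t := Q t j (rev_ord j).

(** The first factor 2 is the cost of [cn1] against the modulus. *)
Lemma coupling_le (Q : R -> 'M[C]_2) (r x : R) : U1 r Q -> x <= 1 ->
  \int[mu]_(s in `[0, x]) coupling b1 b2 (offdiag Q) s <= 2 * (b2 - b1) * r.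
Proof.
move=> [[_ Qi] Qr] x1.
have b21 : 0 <= b2 - b1 by rewrite subr_ge0 ltW// (lt_trans hb1).
have Ni : L1R `[0, 1] (fun t => \sum_(j < 2) \sum_(k < 2) cabs (Q t j k)).
  have Nj j : L1R `[0, 1] (fun t => \sum_(k < 2) cabs (Q t j k)).
    rewrite (_ : (fun _ => _) = fun t => cabs (Q t j j) + cabs (Q t j (rev_ord j))).
      by apply: L1RD => //; exact: L1R_cabs.
    by apply/funext => t; rewrite (sum_ord2 j).
  rewrite (_ : (fun _ => _) = fun t => \sum_(k < 2) cabs (Q t ord0 k) +
      \sum_(k < 2) cabs (Q t (rev_ord ord0) k)); first exact: L1RD.
  by apply/funext => t; rewrite (sum_ord2 ord0).
have ci : L1R `[0, 1] (coupling b1 b2 (offdiag Q)).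
  by apply: coupling_L1 => j; exact: Qi.
have cge0 t : 0 <= coupling b1 b2 (offdiag Q) t by exact: coupling_ge0.
apply: (@le_trans _ _ (\int[mu]_(s in `[0, 1]) coupling b1 b2 (offdiag Q) s)).
  have [x0|x0] := leP 0 x; last first.
    rewrite set_itv_ge ?Rintegral_set0; first exact: Rintegral_ge0.
    by rewrite bnd_simp -ltNge.
  by rewrite -subr_ge0 Rintegral_itvB ?bnd_simp//; apply: Rintegral_ge0 => t _.
apply: (@le_trans _ _ (2 * (b2 - b1) * norm_L1 Q)); last first.
  by rewrite ler_wpM2l// mulr_ge0.
rewrite /norm_L1 -RintegralZl//; apply: le_Rintegral => //; first exact: L1RZl.
move=> t _; rewrite /coupling [2 * _]mulrC -mulrA ler_wpM2l// mulr_sumr ler_sum// => j _.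
rewrite (le_trans (cn1_le_cabs _))// ler_wpM2l// (sum_ord2 j) lerDr cabs_ge0//.
Qed.

Variables (r : R) (Q Qt : R -> 'M[C]_2) (sg : bool).
Hypotheses (UQ : U1 r Q) (UQt : U1 r Qt).
Variables (Y Yt : C -> R -> 'cV[C]_2).
Definition initial_value (k : 'I_2) : C := if k == ord0 then 1 else (-1) ^+ sg.
Hypothesis Ys : forall z, dirac_solution b1 b2 Q z (Y z).
Hypothesis Y0 : forall z, Y z 0 = \col_k initial_value k.
Hypothesis Yts : forall z, dirac_solution b1 b2 Qt z (Yt z).
Hypothesis Yt0 : forall z, Yt z 0 = \col_k initial_value k.

Lemma cn1_initial_value k : cn1 (initial_value k) = 1.
Proof.
rewrite /initial_value /cn1; case: ifP => _; first by rewrite /= normr1 normr0 addr0.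
by case: sg => /=; rewrite ?expr1 ?expr0/= ?oppr0 ?normrN normr1 normr0 addr0.
Qed.

(** The exponent in Gronwall's inequality, by [coupling_le]. *)
Definition coupling_mass : R := 2 * (b2 - b1) * r.
Definition defect (x : R) (lam : C) : R := \sum_(j < 2) sup_int x (fun t =>
  (Q t j (rev_ord j) - Qt t j (rev_ord j)) * cphase (kap j) lam t).
Definition defect_bound (x : R) (lam : C) : R :=
  (b2 - b1) * (1 + coupling_mass * expR coupling_mass) *
  (growth b1 b2 x lam * (4 * defect x lam)) * expR coupling_mass.

(** [stability] for the spectral parameters and weights of [exp_poly_wave]; the
    bound depends on the polynomial only through the conditions on its weight. *)
Lemma filtered_bound (x : R) (lam : C) (P : {poly R}) (j : 'I_2) : 0 < x -> x <= 1 ->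
  (forall t, t \in `[b1 * x, b2 * x] -> 0 <= exp_poly P (rate b2 x) t <= 1) ->
  (forall t, t \in `[b1 * x, b2 * x] -> exp_poly' P (rate b2 x) t <= 0) ->
  cn1 (\sum_(m < size P) (P`_m)%:C%C *
    (Y (lam - 'i%C * (rate b2 x * m%:R)%:C%C) x j ord0 -
     Yt (lam - 'i%C * (rate b2 x * m%:R)%:C%C) x j ord0)) <= defect_bound x lam.
Proof.
move=> x0 x1 W01 W'0.
have sub : `[0, x] `<=` (`[0, 1] : set R).
  by move=> t /=; rewrite !in_itv/= => /andP[->/= /le_trans]; exact.
have Li (A : R -> 'M[C]_2) k : U1 r A -> L1_on `[0, x] (offdiag A k).
  by move=> [[_ Ai] _]; apply: (@L1_itvS _ 0 1) => //; exact: Ai.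
pose p k t := offdiag Q k t - offdiag Qt k t.
have pi k : L1_on `[0, x] (p k) by apply: L1B => //; exact: Li.
have pS k s t : 0 <= s -> s <= t -> t <= x ->
    cn1 (cint `[s, t] (fun r => p k r * wave lam (kap k * r))) <= 4 * defect x lam.
  move=> s0 st tx; rewrite (le_trans (cn1_cint_sup_int _ s0 st tx))//.
    exact: L1_wavemulr.
  apply: ler_wpM2l => //; rewrite /defect (sum_ord2 k).
  have E : (fun u => p k u * wave lam (kap k * u)) =
      (fun t => (Q t k (rev_ord k) - Qt t k (rev_ord k)) * cphase (kap k) lam t).
    by apply/funext => u; rewrite cphase_wave.
  by rewrite E lerDl; exact: sup_int_ge0.
pose lm (m : 'I_(size P)) := lam - 'i%C * (rate b2 x * m%:R)%:C%C.
have sol (A : R -> 'M[C]_2) (Z : C -> R -> 'cV[C]_2) : U1 r A ->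
    (forall z, dirac_solution b1 b2 A z (Z z)) -> (forall z, Z z 0 = \col_k initial_value k) ->
    [/\ forall m k, cmeasurable `[0, x] (fun s => Z (lm m) s k ord0),
        forall m k, exists M, forall s, s \in `[0, x] -> cn1 (Z (lm m) s k ord0) <= M &
        forall m k y, y \in `[0, x] -> Z (lm m) y k ord0 = wave (lm m) (b k * y) *
          (initial_value k + cint `[0, y] (fun s => - 'i%C * (b k)%:C%C *
           (wave (lm m) (- b k * s) * (offdiag A k s * Z (lm m) s (rev_ord k) ord0))))].
  move=> UA Zs Z0; split.
  - move=> m k; have [[m1 m2] _] := dirac_bounded k (Zs (lm m)).
    by split; [apply: measurable_funS m1|apply: measurable_funS m2].
  - move=> m k; have [_ [M hM]] := dirac_bounded k (Zs (lm m)).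
    by exists M => s /sub; exact: hM.
  - move=> m k y yx; rewrite (duhamel hb1 hb2 k UA.1 (Zs (lm m)) (sub _ yx)).
    by rewrite Z0 mxE.
have [my bY yE] := sol Q Y UQ Ys Y0.
have [myt bYt ytE] := sol Qt Yt UQt Yts Yt0.
have x1' := ltW x0.
have initial_le1 k : cn1 (initial_value k) <= 1 by rewrite cn1_initial_value.
exact: (@stability R b1 b2 hb1 hb2 x lam (exp_poly P (rate b2 x)) (exp_poly' P (rate b2 x))
  x1' (is_derive_exp_poly P _) (@continuous_exp_poly' _ P _) W01 (or_intror W'0)
  p (4 * defect x lam) pi pS (size P) (fun m => (P`_m)%:C%C) lm
  (fun t => exp_poly_wave P (rate b2 x) lam t) (offdiag Q) initial_value coupling_mass
  (fun k => Li Q k UQ) (coupling_le UQ x1) (fun k => initial_le1 k)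
  (fun m k s => Y (lm m) s k ord0) my bY yE (offdiag Qt)
  (fun m k s => Yt (lm m) s k ord0) (fun k => Li Qt k UQt) (coupling_le UQt x1)
  myt bYt ytE (fun k s => erefl) j).
Qed.

(** [d j k] is the trace at [x] of the entry [(j, k)] of the difference of the
    kernels. *)
Variables (x : R) (d : 'I_2 -> 'I_2 -> R -> C).
Hypotheses (x0 : 0 < x) (x1 : x <= 1).
Hypothesis d_L1 : forall j k, L1_on `[0, x] (d j k).
Hypothesis dE : forall j z, Y z x j ord0 - Yt z x j ord0 =
  wave_transform b1 b2 x (d j ord0) (fun t => (-1) ^+ sg * d j (rev_ord ord0) t) z.

(** The first column is reached by [first_column_bound]; the constant polynomial 1
    bounds the sum of the two columns, and the second column follows by
    subtraction, whence the factor 2. *)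
Lemma entry_bound lam j k :
  cabs (cint `[0, x] (fun t => d j k t * wave lam (b k * t))) <= 2 * defect_bound x lam.
Proof.
rewrite (le_trans (cabs_le_cn1 _))//.
set k1 := d j ord0; set k2 := (fun t => (-1) ^+ sg * d j (rev_ord ord0) t).
have k1i : L1_on `[0, x] k1 by exact: d_L1.
have k2i : L1_on `[0, x] k2 by apply: L1Zl => //; exact: d_L1.
have tot (P : {poly R}) : \sum_(m < size P) (P`_m)%:C%C *
     wave_transform b1 b2 x k1 k2 (lam - 'i%C * (rate b2 x * m%:R)%:C%C) =
   \sum_(m < size P) (P`_m)%:C%C *
    (Y (lam - 'i%C * (rate b2 x * m%:R)%:C%C) x j ord0 -
     Yt (lam - 'i%C * (rate b2 x * m%:R)%:C%C) x j ord0).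
  by apply: eq_bigr => m _; rewrite dE.
have first : cn1 (cint `[0, x] (fun t => k1 t * wave lam (b1 * t))) <= defect_bound x lam.
  apply: (first_column_bound hb1 hb2 x0 k1i k2i) => n; rewrite tot.
  apply: filtered_bound => // t; rewrite in_itv/= => /andP[_ tx].
    by apply: step_poly01; rewrite expR_ge0/= expR_rate2.
  rewrite mulr_le0_ge0//.
    by apply: step_poly_deriv; rewrite expR_ge0/= expR_rate2.
  by rewrite mulr_ge0 ?expR_ge0// divr_ge0 ?ln_ge0 ?ler1n// mulr_ge0// ltW.
have bound0 : 0 <= defect_bound x lam by apply: le_trans first; exact: cn1_ge0.
have sum1 : cn1 (cint `[0, x] (fun t => k1 t * wave lam (b1 * t)) +
    cint `[0, x] (fun t => k2 t * wave lam (b2 * t))) <= defect_bound x lam.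
  have one t : exp_poly 1 (rate b2 x) t = 1 by rewrite /exp_poly hornerC.
  have E k' bb : cint `[0, x] (fun t => (exp_poly 1 (rate b2 x) (bb * t))%:C%C *
      (k' t * wave lam (bb * t))) = cint `[0, x] (fun t => k' t * wave lam (bb * t)).
    by apply: eq_cint => t _; rewrite one mul1r.
  have := @filtered_wave_transform R b1 b2 x lam k1 k2 k1i k2i 1.
  rewrite !E => <-; rewrite tot; apply: filtered_bound => // t _.
    by rewrite one ler01 lexx.
  by rewrite /exp_poly' derivC hornerC mul0r.
have le2 : defect_bound x lam <= 2 * defect_bound x lam by rewrite ler_peMl// ler1n.
have [->|] := eqVneq k ord0; first exact: le_trans le2.
move=> k0; have -> : k = rev_ord ord0 by case: k k0 => -[|[|//]] kl// _; apply: val_inj.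
set I := cint _ _.
have -> : I = (-1) ^+ sg * cint `[0, x] (fun t => k2 t * wave lam (b2 * t)).
  rewrite -cintZl//; last exact: L1_wavemulr.
  by apply: eq_cint => t _; rewrite /k2 !mulrA -expr2 sqrr_sign mul1r.
rewrite (le_trans (cn1M _ _))// (cn1_initial_value (rev_ord ord0)) mul1r.
rewrite -[cint _ _](addKr (cint `[0, x] (fun t => k1 t * wave lam (b1 * t)))).
by rewrite (le_trans (cn1D _ _))// cn1N mulr_natl mulr2n lerD.
Qed.

End assembly.

Section trace_difference.
Context {R : realType}.
Local Notation mu := (@lebesgue_measure R).
Local Notation C := R[i].

Lemma cint_wave_ae (x c : R) (z : C) (f g : R -> C) :
  L1_on `[0, x] f -> L1_on `[0, x] g ->
  {ae mu, forall t, t \in `[0, x] -> f t = g t} ->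
  cint `[0, x] (fun t => f t * wave z (c * t)) =
  cint `[0, x] (fun t => g t * wave z (c * t)).
Proof.
move=> fi gi [N [mN N0 sub]].
apply: cint_ae; [by []|exact: L1_wavemulr|exact: L1_wavemulr|].
exists N; split => //; apply: subset_trans sub => t /=.
by apply: contra_not => h tx; rewrite h.
Qed.

Lemma wave_transformB (b1 b2 x : R) (c z : C) (f g f' g' : R -> C) :
  L1_on `[0, x] f -> L1_on `[0, x] g -> L1_on `[0, x] f' -> L1_on `[0, x] g' ->
  cint `[0, x] (fun t => f t * wave z (b1 * t) + g t * (c * wave z (b2 * t))) -
  cint `[0, x] (fun t => f' t * wave z (b1 * t) + g' t * (c * wave z (b2 * t))) =
  wave_transform b1 b2 x (fun t => f t - f' t) (fun t => c * (g t - g' t)) z.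
Proof.
have L (k l : R -> C) : L1_on `[0, x] k -> L1_on `[0, x] l ->
    L1_on `[0, x] (fun t => k t * wave z (b1 * t) + l t * (c * wave z (b2 * t))).
  move=> ki li; apply: L1D => //; first exact: L1_wavemulr.
  apply: (L1_eq _ _ (L1_wavemulr z b2 (L1Zl c _ li))) => // t _.
  by rewrite mulrCA mulrA.
move=> fi gi fi' gi'; rewrite -(cintB (measurable_itv _) (L f g fi gi) (L f' g' fi' gi')).
by apply: eq_cint => t _; ring.
Qed.

Lemma trace_mx_entry (K : R * R -> 'M[C]_2) (x t : R) (j k : 'I_2) :
  trace_mx K x t j k = trace_at (fun p => K p j k) x t.
Proof. by rewrite mxE. Qed.

(** A single choice of representatives for the traces serves both for the
    integrals to be bounded and for the transformation formulas of the two
    systems. *)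
Lemma trace_mxB (K Kt : R * R -> 'M[C]_2) (b1 b2 x : R) (s : bool) :
  (forall j k, X0_inf1 (fun p => K p j k)) ->
  (forall j k, X0_inf1 (fun p => Kt p j k)) -> x \in `[0, 1] ->
  exists d : 'I_2 -> 'I_2 -> R -> C, [/\ forall j k, L1_on `[0, x] (d j k),
    forall j k c z,
      cint `[0, x] (fun t => trace_mx (fun p => K p - Kt p) x t j k * wave z (c * t)) =
      cint `[0, x] (fun t => d j k t * wave z (c * t)) &
    forall j z,
      cint `[0, x] (fun t => (trace_mx K x t *m e0 b1 b2 s z t) j ord0) -
      cint `[0, x] (fun t => (trace_mx Kt x t *m e0 b1 b2 s z t) j ord0) =
      wave_transform b1 b2 x (d j ord0) (fun t => (-1) ^+ s * d j (rev_ord ord0) t) z].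
Proof.
move=> KX KtX x1.
have E0 (A : R * R -> 'M[C]_2) j z :
    cint `[0, x] (fun t => (trace_mx A x t *m e0 b1 b2 s z t) j ord0) =
    cint `[0, x] (fun t => trace_at (fun p => A p j ord0) x t * wave z (b1 * t) +
      trace_at (fun p => A p j (rev_ord ord0)) x t * ((-1) ^+ s * wave z (b2 * t))).
  apply: eq_cint => t _; rewrite mxE (sum_ord2 ord0) !trace_mx_entry /e0 !mxE.
  by rewrite !cphase_wave /bcoef/= mul1r.
have E1 j k t : trace_mx (fun p => K p - Kt p) x t j k =
    trace_at (fun p => K p j k - Kt p j k) x t.
  have EK : (fun p => (K p - Kt p) j k) = (fun p => K p j k - Kt p j k).
    by apply/funext => p; rewrite !mxE.
  rewrite trace_mx_entry EK; exact: erefl.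
exists (fun j k t => trace_at (fun p => K p j k) x t - trace_at (fun p => Kt p j k) x t).
split.
- move=> j k; have [L Lt _ _] := trace_atB (KX j k) (KtX j k) x1.
  exact: (L1B (measurable_itv _) L Lt).
- move=> j k c z; have [L Lt LD ae] := trace_atB (KX j k) (KtX j k) x1.
  rewrite -(cint_wave_ae c z LD (L1B (measurable_itv _) L Lt) ae).
  by apply: eq_cint => t _; rewrite E1.
- move=> j z; apply: (etrans (congr2 (fun u v => u - v) (E0 K j z) (E0 Kt j z))).
  have [L0 Lt0 _ _] := trace_atB (KX j ord0) (KtX j ord0) x1.
  have [L1 Lt1 _ _] := trace_atB (KX j (rev_ord ord0)) (KtX j (rev_ord ord0)) x1.
  exact: (wave_transformB b1 b2 ((-1) ^+ s) z L0 L1 Lt0 Lt1).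
Qed.

End trace_difference.

Lemma sum_ord2_neq (V : nmodType) (j : 'I_2) (F : 'I_2 -> V) :
  \sum_(k < 2 | k != j) F k = F (rev_ord j).
Proof.
rewrite big_mkcond (sum_ord2 j) eqxx add0r ifT//.
by case: j => -[|[|]].
Qed.

Lemma col_difference (V : zmodType) (a u v : 'cV[V]_2) (f g : 'I_2 -> V) (j : 'I_2) :
  u = a + \col_i f i -> v = a + \col_i g i -> u j ord0 - v j ord0 = f j - g j.
Proof. by move=> -> ->; rewrite !mxE opprD addrACA subrr add0r. Qed.

Theorem theorem1p2 (R : realType) (b1 b2 r : R) (hb1 : b1 < 0) (hb2 : 0 < b2)
    (hr : 0 < r) :
  exists C : R, 0 < C /\
  forall (Q Qt : R -> 'M[R[i]]_2) (s : bool) (K Kt : R * R -> 'M[R[i]]_2),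
    U1 r Q -> U1 r Qt ->
    transformation_kernel b1 b2 s Q K ->
    transformation_kernel b1 b2 s Qt Kt ->
  forall (x : R) (lambda : R[i]), x \in `[0, 1] ->
    \sum_(j < 2) \sum_(k < 2)
      cabs (cint `[0, x] (fun t =>
        trace_mx (fun p => K p - Kt p) x t j k *
        cphase (bcoef b1 b2 k) lambda t))
    <= C * expR (2 * (b2 - b1) * `|complex.Im lambda| * x) *
       \sum_(j < 2) \sum_(k < 2 | k != j)
         (sup_int x (fun t => (Q t j k - Qt t j k) *
            cphase (bcoef b1 b2 k - bcoef b1 b2 j) lambda t) +
          norm_L1 (fun t => Q t - Qt t) *
          sup_int x (fun t => Qt t j k *
            cphase (bcoef b1 b2 k - bcoef b1 b2 j) lambda t)).
Proof.
have b21 : 0 < b2 - b1 by rewrite subr_gt0 (lt_trans hb1).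
pose ro := coupling_mass b1 b2 r.
have ro0 : 0 <= ro by rewrite !mulr_ge0// ltW.
(* [128 = 4 * 2 * 4 * 4]: four entries, the factor 2 of [entry_bound], the 4 of
   [growth] and the 4 of [cn1_cint_sup_int]. *)
exists (128 * ((b2 - b1) * (1 + ro * expR ro) * expR ro)); split.
  by rewrite !mulr_gt0 ?expR_gt0// ltr_wpDr// mulr_ge0// expR_ge0.
move=> Q Qt s K Kt UQ UQt [KX KY] [KtX KtY] x lam x1.
set E := expR (2 * _ * _ * x); set rhs := (X in _ <= _ * X).
have rhs_le : defect b1 b2 Q Qt x lam <= rhs.
  apply: ler_sum => j _; rewrite sum_ord2_neq lerDl mulr_ge0 ?sup_int_ge0//.
  by apply: Rintegral_ge0 => t _; do 2 apply: sumr_ge0 => ? _; exact: cabs_ge0.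
have defect0 : 0 <= defect b1 b2 Q Qt x lam.
  by apply: sumr_ge0 => j _; exact: sup_int_ge0.
have M0 : 0 <= 128 * ((b2 - b1) * (1 + ro * expR ro) * expR ro) * E.
  have ro1 : 0 <= 1 + ro * expR ro by rewrite addr_ge0// mulr_ge0// expR_ge0.
  apply: mulr_ge0 (expR_ge0 _); apply: mulr_ge0 => //.
  by apply: mulr_ge0 (expR_ge0 _); apply: mulr_ge0 ro1; exact: ltW.
apply: (@le_trans _ _ (128 * ((b2 - b1) * (1 + ro * expR ro) * expR ro) * E * defect b1 b2 Q Qt x lam)); last exact: ler_wpM2l.
have [x0|] := ltP 0 x; last first.
  move=> x0; rewrite big1; first exact: (mulr_ge0 M0 defect0).
  move=> j _; rewrite big1// => k _.
  have -> : x = 0 by apply/eqP; rewrite eq_le x0; move: x1; rewrite in_itv => /andP[].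
  by rewrite cint_set1 cabs_sqrt/= expr0n addr0 sqrtr0.
have [Y YP] := choice KY; have [Yt YtP] := choice KtY.
have xle1 : x <= 1 by move: x1; rewrite in_itv => /andP[].
have [d [d_L1 dE dY]] := @trace_mxB R K Kt b1 b2 x s
  (fun j k => (KX j k).2) (fun j k => (KtX j k).2) x1.
have YB j z : Y z x j ord0 - Yt z x j ord0 =
    wave_transform b1 b2 x (d j ord0) (fun t => (-1) ^+ s * d j (rev_ord ord0) t) z.
  have [_ _ hY] := YP z; have [_ _ hYt] := YtP z.
  exact: (etrans (col_difference j (hY x x1) (hYt x x1)) (dY j z)).
have entry j k : cabs (cint `[0, x] (fun t =>
    trace_mx (fun p => K p - Kt p) x t j k * cphase (bcoef b1 b2 k) lam t)) <=
    2 * defect_bound b1 b2 r Q Qt x lam.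
  have E1 : cint `[0, x] (fun t =>
      trace_mx (fun p => K p - Kt p) x t j k * cphase (bcoef b1 b2 k) lam t) =
      cint `[0, x] (fun t => d j k t * wave lam (bcoef b1 b2 k * t)).
    rewrite -dE; apply: eq_cint => t _; congr (_ * _); exact: cphase_wave.
  rewrite E1; apply: (entry_bound hb1 hb2 UQ UQt _ _ _ _ x0 xle1 d_L1 YB).
  - by move=> z; case: (YP z).
  - by move=> z; case: (YP z).
  - by move=> z; case: (YtP z).
  - by move=> z; case: (YtP z).
apply: (@le_trans _ _ (\sum_(j < 2) \sum_(k < 2) 2 * defect_bound b1 b2 r Q Qt x lam)).
  by apply: ler_sum => j _; apply: ler_sum => k _; exact: entry.
rewrite !sumr_const !card_ord /defect_bound /growth -/E -/ro le_eqVlt; apply/orP; left; apply/eqP.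
by ring.
Qed.
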